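(* Let $P\subseteq \mathbb{R}^2$ be a lattice polygon with $k:=|\mathrm{int}(P)\cap \mathbb{Z}^2|\in \mathbb{Z}_{\geq 1}$, and let $n(\Delta_{P,smooth})$ be the number of rays in the smooth refinement $\Delta_{P,smooth}$ of the normal fan $\Delta_P$ of $P$. Then $$\mathrm{area}(P)=2(k+1)+2-\frac{n(\Delta_{P,smooth})}{2}-\mathrm{area}\left(\mathrm{convhull}(\mathrm{int}(P)\cap \mathbb{Z}^2)\right).$$
   Context: A lattice polygon is a two-dimensional convex polygon in $\mathbb{R}^2$ all of whose vertices lie in $\mathbb{Z}^2$; $\mathrm{int}(P)$ is its interior. The area of a point or a segment is $0$. The normal fan $\Delta_P$ is the complete fan in the dual plane (identified with $\mathbb{R}^2$, with dual lattice identified with $\mathbb{Z}^2$) whose rays are spanned by the inner normal vectors of the edges of $P$ and whose two-dimensional cones correspond to the vertices of $P$. The refinement $\Delta_{P,smooth}$ is obtained from $\Delta_P$ by taking, for each (two-dimensional) cone $\sigma$ of $\Delta_P$, the rays generated by the boundary lattice points lying on the bounded edges of $\mathrm{convhull}(\sigma\cap(\mathbb{Z}^2\setminus\{0\}))$ (these include the two rays bounding $\sigma$); $n(\Delta_{P,smooth})$ is the total number of distinct rays obtained. *)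

(* Defs.v *)
From mathcomp Require Import all_boot all_order all_algebra.
From mathcomp Require Import finmap.
From mathcomp Require Import all_classical all_reals all_analysis.

Set Implicit Arguments.
Unset Strict Implicit.
Unset Printing Implicit Defensive.

Import Order.TTheory GRing.Theory Num.Theory.
Import numFieldNormedType.Exports.

Local Open Scope classical_set_scope.
Local Open Scope ring_scope.

Section Plane.
Context {R : realType}.
Implicit Types (u v x y : R * R) (A E P : set (R * R)).

(* The plane and its dual are both R * R, paired by the dot product. *)
Definition dot u x : R := u.1 * x.1 + u.2 * x.2.

Definition lattice : set (R * R) :=
  [set x | x.1 \is a Num.int /\ x.2 \is a Num.int].

Definition convhull A : set (R * R) := smallest (@convex_set R (R * R)%type) A.

Definition conichull A : set (R * R) :=
  [set x | exists (m : nat) (c : 'I_m -> R) (a : 'I_m -> R * R),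
     (forall i, 0 <= c i /\ A (a i)) /\ x = \sum_(i < m) c i *: a i].

Definition ray u : set (R * R) := [set t *: u | t in [set t : R | 0 <= t]].

Definition area A : \bar R :=
  ((@lebesgue_measure R) \x (@lebesgue_measure R))%E A.

(* Subset of P where the functional dot u is minimal over P: u points into P. *)
Definition face P u : set (R * R) :=
  [set x | P x /\ forall y, P y -> dot u x <= dot u y].

Definition vertex P v : Prop := exists u, face P u = [set v].

(* For a two-dimensional convex P and u != 0, a face with two distinct points
   is one-dimensional. *)
Definition edge P E : Prop :=
  (exists u, u != 0 /\ E = face P u) /\ (exists x y, [/\ E x, E y & x != y]).

Definition inner_normal P E u : Prop := u != 0 /\ E `<=` face P u.

Definition polygon P : Prop :=
  (exists s : seq (R * R), P = convhull [set` s]) /\ interior P !=set0.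

Definition lattice_polygon P : Prop :=
  polygon P /\ vertex P `<=` lattice.

Definition interior_lattice_points P : set (R * R) := interior P `&` lattice.

Definition normal_cone P v : set (R * R) :=
  conichull [set u | exists E, [/\ edge P E, E v & inner_normal P E u]].

Definition smooth_refinement_cone_rays (sigma : set (R * R)) :
    set (set (R * R)) :=
  let K := convhull (sigma `&` (lattice `\ 0)) in
  [set r | exists E p,
     [/\ edge K E, bounded_set E, (E `&` lattice) p & r = ray p]].

Definition smooth_refinement_rays P : set (set (R * R)) :=
  \bigcup_(v in vertex P) smooth_refinement_cone_rays (normal_cone P v).

End Plane.

(* This is 0 when A is infinite. *)
Definition card_set (T : choiceType) (A : set T) : nat := #|` fset_set A|%fset.

(* Main.v *)
Require Import Defs.
From mathcomp Require Import all_boot all_order all_algebra.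
From mathcomp Require Import finmap.
From mathcomp Require Import ring lra zify.
From mathcomp Require Import all_classical all_reals all_analysis.

(** Let [H u] be the minimum of [<u, x>] over [P], and call a nonzero lattice
    vector [u] indecomposable if it is not the sum of two nonzero lattice
    vectors of one normal cone, i.e. if [H a + H b < H u] whenever [u = a + b]
    with [a, b] nonzero.  The rays of the smooth refinement are those spanned by
    the indecomposable vectors, and these form a smooth complete fan [U] with
    [P = {x | H u <= <u, x> for u in U}].  Since [P] has an interior lattice
    point, the lattice points determined by [H + 1] on the cones of [U] satisfy
    [H w + 1 <= <w, x>] for all nonzero lattice vectors [w]; hence the convex
    hull of the interior lattice points is
    [{x | H u + 1 <= <u, x> for u in U}].

    It remains to prove, for a smooth complete fan with [n] rays and data [h]
    such that [h] and [h + 1] are both globally nef, that the two polygons have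
    total area [2 k + 4 - n / 2], where [k] is the number of lattice points of
    the smaller one.  This goes by induction on [n].  Contracting a ray
    [u = p + s] between its neighbours adds to the two polygons unimodular
    triangles of sizes [t = h u - h p - h s] and [t - 1], and
    [t^2/2 + (t-1)^2/2 = 2 * (t(t-1)/2) + 1/2].  If no ray can be contracted,
    a longest ray vector [u] has neighbours with [p + s = - u] or [p + s = 0],
    and the fan is that of the projective plane or of a Hirzebruch surface. *)

Set Implicit Arguments.
Unset Strict Implicit.
Unset Printing Implicit Defensive.

Import Order.TTheory GRing.Theory Num.Theory.
Import numFieldNormedType.Exports.

Local Open Scope ring_scope.

(** * Smooth complete fans and their contractions *)

(** The constant is that of Riemann-Roch on the toric surface of [U]. With [L] the divisor of [h]
    and [K] the canonical divisor, the areas are [L^2/2] and [(L + K)^2/2], the number of points is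
    [k = 1 + L(L + K)/2], and Noether's formula gives [K^2 = 12 - n]; so the areas add up to
    [L^2 + LK + K^2/2 = 2k - 2 + (12 - n)/2]. The induction replaces these theorems by blowing down.
    The data cannot be assumed ample: a ray of [U] that is not an edge normal of [P] touches [P]
    only in a vertex, and the polygon of [h + 1] may be a segment or a point. Nefness survives
    contraction, and for [h + 1] it gives [t >= 1]. The triangles added are half-open, hence
    disjoint from the old polygon, so that areas and numbers of lattice points add without boundary
    corrections. *)

Lemma seq_argmax (R : realDomainType) (T : eqType) (f : T -> R) (s : seq T) :
  s != [::] -> exists2 x, x \in s & forall y, y \in s -> f y <= f x.
Proof.
elim: s => // a s IH _; have [->|/IH[x xs xmax]] := eqVneq s [::].
  by exists a => [|y]; rewrite ?mem_head// inE => /eqP->.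
have [fxa|fax] := leP (f x) (f a).
  exists a => [|y]; rewrite ?mem_head// inE => /orP[/eqP->//|/xmax fy].
  exact: le_trans fy fxa.
exists x => [|y]; rewrite inE ?xs ?orbT// => /orP[/eqP->|/xmax//].
exact: ltW.
Qed.

(** Serves to tilt a functional, by adding a large multiple of it to another one, while keeping
    finitely many inequalities. *)
Lemma eventually_all (R : realDomainType) (T : eqType) (Q : R -> T -> Prop) (s : seq T) :
  (forall b, b \in s -> exists2 N : R, 0 <= N & forall M, N <= M -> Q M b) ->
  exists2 N : R, 0 <= N & forall M, N <= M -> forall b, b \in s -> Q M b.
Proof.
elim: s => [_|a s IH H]; first by exists 0.
have [N N0 HN] := H a (mem_head _ _).
have [|N' N'0 HN'] := IH; first by move=> b bs; apply: H; rewrite inE bs orbT.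
exists (N + N') => [|M NM b]; first by rewrite addr_ge0.
rewrite inE => /predU1P[->|bs]; first by apply: HN; lra.
by apply: HN' => //; lra.
Qed.

Definition det (a b : int * int) : int := a.1 * b.2 - a.2 * b.1.

Lemma detC a b : det b a = - det a b.
Proof. rewrite /det; ring. Qed.

Lemma detxx a : det a a = 0.
Proof. rewrite /det; ring. Qed.

Lemma plucker a b c d : det a b * det c d = det a c * det b d - det a d * det b c.
Proof. rewrite /det; ring. Qed.

Lemma det_coord a b u : det a b = 1 ->
  u = (det u b * a.1 + det a u * b.1, det u b * a.2 + det a u * b.2).
Proof.
move: a b u => [a1 a2] [b1 b2] [u1 u2]; rewrite /det /= => H.
have E (x : int) : x = (a1 * b2 - a2 * b1) * x by rewrite H mul1r.
by rewrite {1}(E u1) {1}(E u2); congr pair; ring.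
Qed.

Lemma det_coord_inj a b u w : det a b = 1 -> det u b = det w b ->
  det a u = det a w -> u = w.
Proof.
by move=> D E1 E2; rewrite (det_coord u D) (det_coord w D) E1 E2.
Qed.

(** When [det a b = 1], [u = det u b * a + det a u * b], so the excluded condition says that [u]
    lies in the open cone of [a] and [b]: the two rays span a maximal cone, and [b] follows [a]
    counterclockwise. *)
Definition adj (U : seq (int * int)) a b :=
  (det a b == 1) && all (fun u => ~~ ((0 < det a u) && (0 < det u b))) U.

Lemma adj_det U a b : adj U a b -> det a b = 1.
Proof. by case/andP => /eqP. Qed.

Lemma adjP U a b : reflect (det a b = 1 /\
   forall u, u \in U -> 0 < det a u -> 0 < det u b -> False) (adj U a b).
Proof.
apply: (iffP andP) => [[/eqP D /allP H]|[D H]]; split=> //.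
- by move=> u /H /negP K p q; apply: K; rewrite p q.
- exact/eqP.
- by apply/allP => u /H K; apply/negP => /andP[/K].
Qed.

(** If [det a c > 0] then, as [det c b = 1], the ray [c] lies inside the cone of [a] and [b]; the
    other sign is symmetric. If [det a c = 0], then [a] and [c] have the same coordinates in the
    basis [a, b]. *)
Lemma adj_predI U a b c : a \in U -> c \in U -> adj U a b -> adj U c b -> a = c.
Proof.
move=> aU cU /adjP[Dab Hab] /adjP[Dcb Hcb].
have [l|g|e] := ltrgt0P (det a c).
- by case: (Hab _ cU l); rewrite Dcb.
- by case: (Hcb _ aU); rewrite ?Dab// detC oppr_gt0.
- by apply: (det_coord_inj Dab); rewrite ?Dab ?Dcb// e /det; lia.
Qed.

Lemma adj_succI U a b c : b \in U -> c \in U -> adj U a b -> adj U a c -> b = c.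
Proof.
move=> bU cU /adjP[Dab Hab] /adjP[Dac Hac].
have [l|g|e] := ltrgt0P (det b c).
- by case: (Hac _ bU); rewrite ?Dab.
- by case: (Hab _ cU); rewrite ?Dac// detC oppr_gt0.
- by apply: (det_coord_inj Dab); rewrite ?Dab ?Dac// (detC b c) e /det; lia.
Qed.

(* [U] lists the primitive ray generators of a smooth complete fan; completeness is
   encoded by the existence of counterclockwise neighbours. *)
Definition fan (U : seq (int * int)) :=
  uniq U /\ forall a, a \in U -> exists2 b, b \in U & adj U a b.

(** By [adj_predI] the successor map is injective on the finite list [U], hence onto. *)
Lemma fan_pred U b : fan U -> b \in U -> exists2 a, a \in U & adj U a b.
Proof.
case=> Uu Us bU.
pose f a := nth (0, 0) U (find (adj U a) U).
have fU a : a \in U -> f a \in U /\ adj U a (f a).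
  move=> /Us[c cU ac]; have H : has (adj U a) U by apply/hasP; exists c.
  by split; [rewrite mem_nth// -has_find|apply: nth_find].
have finj : {in U &, injective f}.
  move=> x y xU yU E; have [_ Ax] := fU _ xU; have [_ Ay] := fU _ yU.
  by apply: (@adj_predI U x (f x) y) => //; rewrite E.
have mu : uniq (map f U) by rewrite map_inj_in_uniq.
have ms : {subset map f U <= U} by move=> _ /mapP[x /fU[xU _] ->].
have [_ E] := uniq_min_size mu ms (eq_leq (esym (size_map f U))).
move: bU; rewrite -E => /mapP[a aU ->]; exists a => //.
by case: (fU _ aU).
Qed.

(** Identifies an element of [U] from the ray it lies on: [x] has a neighbour [z] with
    [det x z = 1], so [m] divides 1. *)
Lemma fan_primitive U x y m : fan U -> x \in U -> 0 < m ->
  x = (m * y.1, m * y.2) -> x = y.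
Proof.
case=> _ Us /Us[z _ /adj_det D] m0 E.
have : m * det y z = 1 by rewrite -D E /det /=; ring.
move=> mz; have d0 : 0 < det y z by rewrite -(pmulr_rgt0 _ m0) mz.
have m1 : m = 1 by nia.
by rewrite E m1 !mul1r -surjective_pairing.
Qed.

(** The wall relation [a + c = det a c * b] of consecutive rays, tested against [u]. *)
Lemma det_combr a b c u : det a b = 1 -> det b c = 1 ->
  det u a + det u c = det a c * det u b.
Proof.
move=> D1 D2; rewrite -[det u a]mulr1 -[det u c]mulr1 -{1}D2 -D1.
rewrite /det; ring.
Qed.

Lemma det_combl a b c u : det a b = 1 -> det b c = 1 ->
  det a u + det c u = det a c * det b u.
Proof.
move=> D1 D2; rewrite (detC u a) (detC u c) (detC u b) mulrN -(det_combr u D1 D2)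
  [RHS]opprD //.
Qed.

Section contraction.
Variables (U : seq (int * int)) (p u s : int * int).
Hypotheses (fU : fan U) (pU : p \in U) (uU : u \in U) (sU : s \in U).
Hypotheses (pu : adj U p u) (us : adj U u s) (ps : det p s = 1).

Let Dpu := adj_det pu.
Let Dus := adj_det us.

Lemma contract_sum : u = (p.1 + s.1, p.2 + s.2).
Proof. by rewrite {1}(det_coord u ps) Dpu Dus !mul1r. Qed.

Lemma contract_neq : p != u /\ s != u.
Proof.
by split; apply/eqP => E; [move: Dpu|move: Dus]; rewrite E detxx.
Qed.

Lemma contract_detr w : det w u = det w s - det p w.
Proof. rewrite {1}contract_sum /det /=; ring. Qed.

Lemma contract_detl w : det u w = det p w - det w s.
Proof. by rewrite detC contract_detr opprB. Qed.

Lemma contract_adj : adj (rem u U) p s.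
Proof.
apply/adjP; split=> // x; case: (fU) => Uu _.
rewrite (mem_rem_uniq _ Uu) inE => /andP[xu xU] j0 i0.
have [_ /(_ x xU j0) H1] := adjP _ _ _ pu.
have [_ /(_ x xU)/(_ _ i0) H2] := adjP _ _ _ us.
(* [x] avoids the open cones on both sides of [u], so it lies on the ray of [u] itself. *)
have E : det x s = det p x.
  by have := contract_detr x; have := contract_detl x; lia.
have : x = u; last by move/eqP: xu.
apply: (@fan_primitive U x u (det p x)) => //.
rewrite {1}(det_coord x ps) E {1 2}contract_sum /=; congr pair; ring.
Qed.

Lemma adj_rem a b : adj U a b -> adj (rem u U) a b.
Proof.
by case/adjP=> D H; apply/adjP; split=> // x /mem_rem; exact: H.
Qed.

Lemma fan_rem : fan (rem u U).
Proof.
case: (fU) => Uu Us; split; first exact: rem_uniq.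
move=> a; rewrite (mem_rem_uniq _ Uu) inE => /andP[au aU].
have [b bU ab] := Us _ aU; have [bu|bu] := eqVneq b u; last first.
  by exists b; [rewrite (mem_rem_uniq _ Uu) inE bu|exact: adj_rem].
have -> : a = p by apply: (@adj_predI U a u p) => //; rewrite -bu.
exists s; last exact: contract_adj.
by rewrite (mem_rem_uniq _ Uu) inE sU andbT (proj2 contract_neq).
Qed.

(** Only the successor of [p] changes: it was [u] and becomes [s]. *)
Lemma contract_adj_cases a b : a \in rem u U -> b \in rem u U ->
  adj (rem u U) a b -> (a = p /\ b = s) \/ [/\ a \in U, b \in U & adj U a b].
Proof.
case: (fU) => Uu Us; rewrite (mem_rem_uniq _ Uu) inE => /andP[au aU] bR ab.
have bU := mem_rem bR.
have [c cU ac] := Us _ aU; have [cu|cu] := eqVneq c u.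
  have ap : a = p by apply: (@adj_predI U a u p) => //; rewrite -cu.
  left; split=> //; apply: (@adj_succI (rem u U) p) => //.
  - by rewrite (mem_rem_uniq _ Uu) inE sU andbT (proj2 contract_neq).
  - by rewrite -ap.
  - exact: contract_adj.
right; suff -> : b = c by [].
apply: (@adj_succI (rem u U) a) => //; last exact: adj_rem.
by rewrite (mem_rem_uniq _ Uu) inE cu.
Qed.

End contraction.

(* With [p + s = al u] and [N] the squared norm:
   [al^2 N(u) = N(p + s) = 2 (N(p) + N(s)) - N(p - s) < 4 N(u)]. *)
Lemma parallelogram_lt (p1 p2 s1 s2 u1 u2 al : int) :
  p1 + s1 = al * u1 -> p2 + s2 = al * u2 ->
  p1 ^+ 2 + p2 ^+ 2 <= u1 ^+ 2 + u2 ^+ 2 ->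
  s1 ^+ 2 + s2 ^+ 2 <= u1 ^+ 2 + u2 ^+ 2 ->
  ~ (p1 = s1 /\ p2 = s2) -> al ^+ 2 < 2 ^+ 2.
Proof.
move=> F1 F2 Np Ns nz.
have lt0 : 0 < (p1 - s1) ^+ 2 + (p2 - s2) ^+ 2.
  rewrite lt_neqAle eq_sym addr_ge0 ?sqr_ge0// andbT.
  rewrite paddr_eq0 ?sqr_ge0// !sqrf_eq0 !subr_eq0.
  by apply/negP => /andP[/eqP ? /eqP ?]; apply: nz.
have : (al * u1) ^+ 2 + (al * u2) ^+ 2 = (p1 + s1) ^+ 2 + (p2 + s2) ^+ 2.
  by rewrite F1 F2.
rewrite !exprMn -mulrDr => E; rewrite ltNge; apply/negP => al2.
have : 2 ^+ 2 * (u1 ^+ 2 + u2 ^+ 2) <= al ^+ 2 * (u1 ^+ 2 + u2 ^+ 2).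
  by rewrite ler_wpM2r ?addr_ge0 ?sqr_ge0.
rewrite E; move: Np Ns lt0; clear; lra.
Qed.

(** Among the rays strictly inside the cone of [a] and [b], take [u] of maximal norm in the
    coordinates of that basis. Its neighbours [p] and [s] lie in the closed cone and are not longer,
    so [parallelogram_lt] gives [det p s < 2], while [det p s > 0] since [p + s] is a positive
    multiple of [u]. *)
Lemma exists_contractible U a b x : fan U -> a \in U -> b \in U ->
  det a b = 1 -> x \in U -> 0 < det a x -> 0 < det x b ->
  exists p u s, [/\ p \in U, u \in U & s \in U] /\
    [/\ adj U p u, adj U u s & det p s = 1].
Proof.
move=> fU aU bU Dab xU ax xb.
pose N (w : int * int) : int := det w b ^+ 2 + det a w ^+ 2.
pose L := [seq w <- U | (0 < det a w) && (0 < det w b)].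
have L0 : L != [::].
  by apply/eqP => L0; have : x \in L; [rewrite mem_filter ax xb|rewrite L0].
have [u uL umax] := seq_argmax N L0.
move: uL; rewrite mem_filter => /andP[/andP[au ub] uU].
have [p pU pu] := fan_pred fU uU; have [_ Us] := fU.
have [s sU us] := Us _ uU.
exists p, u, s; split=> //; split=> //.
have Dpu := adj_det pu; have Dus := adj_det us.
have ap : 0 <= det a p.
  rewrite leNgt; apply/negP => K; have [_ /(_ a aU) H] := adjP _ _ _ pu.
  by apply: H => //; rewrite detC oppr_gt0.
have sb : 0 <= det s b.
  rewrite leNgt; apply/negP => K; have [_ /(_ b bU) H] := adjP _ _ _ us.
  by apply: H => //; rewrite detC oppr_gt0.
have E1 := plucker a b p u; rewrite Dab Dpu (detC u b) (detC p b) in E1.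
have E2 := plucker a b u s; rewrite Dab Dus (detC u b) (detC s b) in E2.
have E1' : det p b * det a u = 1 + det a p * det u b by lia.
have E2' : det u b * det a s = 1 + det a u * det s b by lia.
have pb : 0 < det p b by rewrite -(pmulr_lgt0 _ au) E1'; lia.
have as_ : 0 < det a s by rewrite -(pmulr_rgt0 _ ub) E2'; lia.
have Np : N p <= N u.
  (* If [det a p = 0], then [p] is not in [L], but [E1'] reads [det p b * det a u = 1], whence
     [N p = 1]. *)
  move: ap; rewrite le_eqVlt => /orP[/eqP ap|ap].
    by rewrite /N -ap; move: E1' pb au ub; rewrite -ap; clear;
      move: (det p b) (det a u) (det u b); nia.
  by apply: umax; rewrite mem_filter ap pb.
have Ns : N s <= N u.
  move: sb; rewrite le_eqVlt => /orP[/eqP sb|sb].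
    by rewrite /N -sb; move: E2' as_ au ub; rewrite -sb; clear;
      move: (det a s) (det a u) (det u b); nia.
  by apply: umax; rewrite mem_filter sb as_.
have F1 := det_combl b Dpu Dus; have F2 := det_combr a Dpu Dus.
have nps : ~ (det p b = det s b /\ det a p = det a s).
  case=> K1 K2; have psE : p = s by apply: (det_coord_inj Dab).
  by move: Dpu Dus; rewrite psE detC; lia.
have al0 : 0 < det p s by rewrite -(pmulr_lgt0 _ ub) -F1; lia.
have := parallelogram_lt F1 F2 Np Ns nps.
by rewrite ltr_sqr ?nnegrE// 1?ltW//; move: al0; clear; lia.
Qed.

Definition comb (i j : int) (a b : int * int) : int * int :=
  (i * a.1 + j * b.1, i * a.2 + j * b.2).

Lemma det_combE i j k l a b :
  det (comb i j a b) (comb k l a b) = (i * l - j * k) * det a b.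
Proof. rewrite /det /comb /=; ring. Qed.

Lemma det_comb_b i j a b : det (comb i j a b) b = i * det a b.
Proof. rewrite /det /comb /=; ring. Qed.

Lemma det_comb_a i j a b : det (comb i j a b) a = - j * det a b.
Proof. rewrite /det /comb /=; ring. Qed.

Lemma det_a_comb i j a b : det a (comb i j a b) = j * det a b.
Proof. rewrite /det /comb /=; ring. Qed.

Lemma det_b_comb i j a b : det b (comb i j a b) = - i * det a b.
Proof. rewrite /det /comb /=; ring. Qed.

Definition detE := (det_comb_b, det_comb_a, det_a_comb, det_b_comb, det_combE).

Lemma coordP a b u : det a b = 1 -> exists i j, u = comb i j a b.
Proof. by move=> D; exists (det u b), (det a u); exact: det_coord. Qed.

Lemma adj_exclude U a b x : adj U a b -> x \in U -> ~~ ((0 < det a x) && (0 < det x b)).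
Proof. by case/andP=> _ /allP/[apply]. Qed.

(** * Fans without a contractible ray *)

Section base.
Variable U : seq (int * int).
Hypothesis fU : fan U.
Hypothesis min : forall p u s, p \in U -> u \in U -> s \in U ->
  adj U p u -> adj U u s -> det p s <> 1.

Lemma min_adj a b : a \in U -> b \in U -> det a b = 1 -> adj U a b.
Proof.
move=> aU bU D; apply/adjP; split=> // x xU ax xb.
have [p [u [s [[pU uU sU] [pu us ps]]]]] := exists_contractible fU aU bU D xU ax xb.
exact: (min pU uU sU pu us).
Qed.

(** The [u] bound in the conclusion is a longest vector of [U]. It satisfies [p + s = j u] with
    [j^2 < 4], and [j = 1] would make it contractible. *)
Lemma min_turn u : u \in U -> exists p u s, [/\ p \in U, u \in U & s \in U] /\
  [/\ adj U p u, adj U u s & (s = comb (-1) 0 p u) \/ (s = comb (-1) (-1) p u)].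
Proof.
move=> u0U.
have U0 : U != [::] by apply/eqP => E; move: u0U; rewrite E.
have [v vU vmax] := seq_argmax (fun w : int * int => w.1 ^+ 2 + w.2 ^+ 2) U0.
have [p pU pv] := fan_pred fU vU; have [_ Us] := fU.
have [s sU vs] := Us _ vU; exists p, v, s; split=> //; split=> //.
have Dpv := adj_det pv; have Dvs := adj_det vs; have Np := vmax _ pU;
  have Ns := vmax _ sU.
have [i [j sE]] := coordP s Dpv.
have i1 : i = -1.
  by move: Dvs; rewrite sE detE Dpv; lia.
have E1 : p.1 + s.1 = j * v.1 by rewrite sE i1 /=; ring.
have E2 : p.2 + s.2 = j * v.2 by rewrite sE i1 /=; ring.
have nps : ~ (p.1 = s.1 /\ p.2 = s.2).
  case=> K1 K2; have psE : p = s by rewrite (surjective_pairing p) (surjective_pairing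
    s) K1 K2.
  by move: Dpv Dvs; rewrite psE detC; lia.
have j1 : j <> 1.
  move=> j1; apply: (min pU vU sU pv vs).
  by rewrite sE detE Dpv j1.
have j2 := parallelogram_lt E1 E2 Np Ns nps.
have : j = 0 \/ j = -1 by move: j1 j2; clear; rewrite !expr2; nia.
by rewrite sE i1; case=> ->; [left|right].
Qed.

(** [min_adj] closes the cycle of cones around the origin. These cones cover the plane, so every ray
    of [U] lies on one of their boundary rays, and primitivity makes it the listed one. *)
Lemma min_classification u : u \in U ->
  exists p u, [/\ det p u = 1, p \in U & u \in U] /\
   ((exists s, [/\ s = comb (-1) (-1) p u, adj U p u, adj U u s, adj U s p
     & U =i [:: p; u; s]]) \/
    (exists q s c, [/\ q = comb (-1) 0 p u & s = comb c (-1) p u] /\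
      [/\ adj U p u, adj U u q, adj U q s, adj U s p & U =i [:: p; u; q; s]])).
Proof.
move=> /min_turn[p [{}u [s [[pU uU sU] [pu us alt]]]]].
have D := adj_det pu; exists p, u; split=> //.
have prim := fan_primitive fU.
case: alt => sE; [right|left]; last first.
  exists s; have sp : adj U s p.
    by apply: min_adj => //; rewrite sE detE D.
  split=> // x; rewrite !inE; apply/idP/idP => [xU|]; last first.
    by case/or3P => /eqP->.
  have := adj_exclude sp xU; have := adj_exclude us xU; have := adj_exclude pu xU.
  have [i [j xE]] := coordP x D.
  rewrite {1 2 3 4 5 6}xE sE !detE D.
  rewrite !negb_and -!leNgt => H1 H2 H3.
  have : (j = 0 /\ 0 < i) \/ (i = 0 /\ 0 < j) \/ (i = j /\ i < 0) \/ (i = 0 /\ j = 0).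
    by lia.
  case=> [[j0 i0]|[[i0 j0]|[[ij i0]|[i0 j0]]]].
  - by rewrite (prim x p i xU i0) ?eqxx// xE j0 /comb; congr pair; ring.
  - by rewrite (prim x u j xU j0) ?eqxx ?orbT// xE i0 /comb; congr pair; ring.
  - have -> : x = s; last by rewrite sE eqxx !orbT.
    apply: (prim x s (- i) xU); first by move: i0; clear; lia.
    by rewrite xE sE -ij /comb; congr pair => /=; ring.
  - have [_ /(_ x xU)[y _ /adj_det xy]] := fU.
    suff : det x y = 0 by rewrite xy.
  by rewrite xE i0 j0 /det /comb /=; ring.
have [_ Us] := fU; have [t tU st] := Us _ sU; have [r rU rp] := fan_pred fU pU.
(* Here [s] is [- p]. Its successor [t] and the predecessor [r] of [p] both have [u]-coordinate -1,
   by the determinants with [- p] and [p]; [min_adj] makes [t] a predecessor of [p] too, so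
   [t = r]. *)
have tE : t = comb (det t u) (-1) p u.
  have [i [j tE]] := coordP t D.
  have := adj_det st; rewrite sE {1}tE detE D => E.
  rewrite tE detE D; congr comb; lia.
have rE : r = comb (det r u) (-1) p u.
  have [i [j rE]] := coordP r D.
  have := adj_det rp; rewrite {1}rE detE D => E.
  rewrite rE detE D; congr comb; lia.
have tp : adj U t p.
  by apply: min_adj => //; rewrite tE detE D.
have Ut : r = t by apply: (adj_predI rU tU rp tp).
exists s, t, (det t u); split=> //; split=> // x; rewrite !inE.
apply/idP/idP => [xU|]; last by case/or4P => /eqP->.
have := adj_exclude tp xU; have := adj_exclude st xU.
have := adj_exclude us xU; have := adj_exclude pu xU.
have [i [j xE]] := coordP x D; move: (det t u) tE => c tE.
rewrite {1 2 3 4 5 6 7 8}xE sE tE !detE D.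
rewrite !negb_and -!leNgt => H1 H2 H3 H4.
have : (j = 0 /\ 0 < i) \/ (i = 0 /\ 0 < j) \/ (j = 0 /\ i < 0) \/ (i = 0 /\ j = 0)
  \/ (j < 0 /\ i = - j * c) by lia.
case=> [[j0 i0]|[[i0 j0]|[[j0 i0]|[[i0 j0]|[j0 ij]]]]].
- by rewrite (prim x p i xU i0) ?eqxx// xE j0 /comb; congr pair; ring.
- by rewrite (prim x u j xU j0) ?eqxx ?orbT// xE i0 /comb; congr pair; ring.
- have -> : x = s; last by rewrite sE eqxx !orbT.
  apply: (prim x s (- i) xU); first by move: i0; clear; lia.
  by rewrite xE sE j0 /comb; congr pair => /=; ring.
- have [_ /(_ x xU)[y _ /adj_det xy]] := fU.
  suff : det x y = 0 by rewrite xy.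
  by rewrite xE i0 j0 /det /comb /=; ring.
- have -> : x = t; last by rewrite tE eqxx !orbT.
  apply: (prim x t (- j) xU); first by move: j0; clear; lia.
  by rewrite xE tE ij /comb; congr pair => /=; ring.
Qed.

End base.

Lemma det_neq c a b : det c a != det c b -> a != b.
Proof. by apply: contraNneq => ->. Qed.

Lemma fan_ind (Pr : seq (int * int) -> Prop) :
  (forall U p u s, s = comb (-1) (-1) p u -> fan U ->
    adj U p u -> adj U u s -> adj U s p -> perm_eq U [:: p; u; s] -> Pr U) ->
  (forall U p u q s c, q = comb (-1) 0 p u -> s = comb c (-1) p u -> fan U ->
    adj U p u -> adj U u q -> adj U q s -> adj U s p ->
    perm_eq U [:: p; u; q; s] -> Pr U) ->
  (forall U p u s, fan U -> p \in U -> u \in U -> s \in U ->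
    adj U p u -> adj U u s -> det p s = 1 -> Pr (rem u U) -> Pr U) ->
  forall U, fan U -> U != [::] -> Pr U.
Proof.
move=> base3 base4 step U.
move: {2}(size U) (leqnn (size U)) => n; elim: n U => [|n IH] U.
  by rewrite leqn0 size_eq0 => /eqP->.
move=> sz fU U0; have Uu := proj1 fU.
have [[p [u [s [pU uU sU [pu us ps]]]]]|no] := pselect (exists p u s,
    [/\ p \in U, u \in U, s \in U & [/\ adj U p u, adj U u s & det p s = 1]]).
  apply: (step _ p u s) => //; apply: IH.
  - rewrite size_rem// -ltnS; apply: leq_trans sz; rewrite prednK//.
    by rewrite lt0n size_eq0.
  - exact: (@fan_rem U p u s).
  - have : p \in rem u U.
      rewrite (mem_rem_uniq _ Uu) inE pU andbT.
      by have [] := contract_neq pu us.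
    by case: (rem u U).
have min p u s : p \in U -> u \in U -> s \in U -> adj U p u -> adj U u s -> det p s <> 1.
  by move=> pU uU sU pu us ps; apply: no; exists p, u, s.
have [x xU] : exists x, x \in U by case: (U) U0 => // x l _; exists x; rewrite mem_head.
have [p [u [[D pU uU]]]] := min_classification fU min xU.
case=> [[s [sE pu us sp E]]|[q [s [c [[qE sE] [pu uq qs sp E]]]]]].
  apply: (base3 _ p u s) => //; apply: uniq_perm => //.
  rewrite /= !inE !negb_or !andbT; do !(apply/andP; split).
  - by rewrite (det_neq (c := p))// D detxx.
  - by rewrite (det_neq (c := p))// sE detE D detxx.
  - by rewrite (det_neq (c := u))// sE detE D detxx.
apply: (base4 _ p u q s c) => //; apply: uniq_perm => //.
rewrite /= !inE !negb_or !andbT; do !(apply/andP; split).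
- by rewrite (det_neq (c := p))// D detxx.
- by rewrite (det_neq (c := u))// qE detE detC D.
- by rewrite (det_neq (c := p))// sE detE D detxx.
- by rewrite (det_neq (c := p))// qE detE D.
- by rewrite (det_neq (c := p))// sE detE D.
- by rewrite (det_neq (c := p))// qE sE !detE D.
Qed.

(* By [det_coord], the right-hand side is the value [<w, v>] at the point [v] with
   [<a, v> = h a] and [<b, v> = h b]. *)
Definition globally_nef (U : seq (int * int)) (h : int * int -> int) :=
  forall a b, a \in U -> b \in U -> adj U a b ->
  forall w, w \in U -> h w <= det w b * h a + det a w * h b.

(** * Nef data and their polygons under contraction *)

Section contraction.
Variables (U : seq (int * int)) (p u s : int * int) (h : int * int -> int).
Hypotheses (fU : fan U) (pU : p \in U) (uU : u \in U) (sU : s \in U).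
Hypotheses (pu : adj U p u) (us : adj U u s) (ps : det p s = 1).
Hypothesis nef : globally_nef U h.

Let t := h u - (h p + h s).

Lemma contract_nef_ge0 : 0 <= t.
Proof.
have := nef pU uU pu sU; rewrite (detC u s) (adj_det us) ps.
by rewrite /t; lia.
Qed.

(** The nef bounds from the cones [p, u] and [u, s], rewritten as the bound of the merged cone
    [p, s] plus a multiple of [t]. Outside the open merged cone one of the two multiples is at most
    0. *)
Lemma contract_bound w : w \in U ->
  h w <= det w s * h p + det p w * h s + det p w * t /\
  h w <= det w s * h p + det p w * h s + det w s * t.
Proof.
move=> wU; have := nef pU uU pu wU; have := nef uU sU us wU.
rewrite (contract_detl pu us ps) (contract_detr pu us ps) /t.
by split; lra.
Qed.

Lemma contract_outside w : w \in rem u U -> (det w s <= 0) || (det p w <= 0).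
Proof.
move=> wR; have := adj_exclude (contract_adj fU pU uU sU pu us ps) wR.
by rewrite negb_and -!leNgt orbC.
Qed.

Lemma contract_nef : globally_nef (rem u U) h.
Proof.
move=> a b aR bR ab w wR.
case: (contract_adj_cases fU pU uU sU pu us ps aR bR ab) => [[-> ->]|[aU bU abU]];
  last first.
  by apply: nef => //; exact: mem_rem wR.
have [H1 H2] := contract_bound (mem_rem wR); have t0 := contract_nef_ge0.
case/orP: (contract_outside wR) => i0; [apply: le_trans H2 _|apply: le_trans H1 _].
  by rewrite gerDl mulr_le0_ge0.
by rewrite gerDl mulr_le0_ge0.
Qed.

End contraction.

Definition pairing (R : realDomainType) (u : int * int) (x : R * R) : R :=
  u.1%:~R * x.1 + u.2%:~R * x.2.

Lemma pairing_comb (R : realDomainType) i j a b (x : R * R) :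
  pairing (comb i j a b) x = i%:~R * pairing a x + j%:~R * pairing b x.
Proof. rewrite /pairing /comb /= !intrD !intrM; ring. Qed.

Lemma pairing_coord (R : realDomainType) a b u (x : R * R) : det a b = 1 ->
  pairing u x = (det u b)%:~R * pairing a x + (det a u)%:~R * pairing b x.
Proof. by move=> D; rewrite {1}(det_coord u D) -pairing_comb. Qed.

Definition support_ineqs (R : realDomainType) (U : seq (int * int)) (h : int * int ->
  int) (x : R * R) : Prop :=
  forall u, u \in U -> (h u)%:~R <= pairing u x.

(** Dropping the inequality of [u] adds exactly a half-open triangle, unimodular in the coordinates
    [pairing p] and [pairing s]: no other ray cuts into it. *)
Lemma contract_region (R : realDomainType) U p u s h (x : R * R) :
  fan U -> p \in U -> u \in U -> s \in U ->
  adj U p u -> adj U u s -> det p s = 1 -> globally_nef U h ->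
  (support_ineqs (rem u U) h x /\ pairing u x < (h u)%:~R) <->
  [/\ (h p)%:~R <= pairing p x, (h s)%:~R <= pairing s x & pairing p x + pairing s x <
    (h u)%:~R].
Proof.
move=> fU pU uU sU pu us ps nef.
have Uu := proj1 fU; have [npu nsu] := contract_neq pu us.
have uE : pairing u x = pairing p x + pairing s x.
  by rewrite (pairing_coord u x ps) (adj_det pu) (adj_det us) !mul1r.
rewrite -uE; split=> [[Q xu]|[px sx xu]].
  by split=> //; apply: Q; rewrite (mem_rem_uniq _ Uu) inE ?npu ?nsu.
split=> // w wR; rewrite (pairing_coord w x ps).
have [] := contract_bound pU uU sU pu us ps nef (mem_rem wR).
move: (contract_outside fU pU uU sU pu us ps wR) (contract_nef_ge0 pU uU sU pu us ps nef).
move: uE px sx xu; move: (h w) (h p) (h s) (h u) (pairing p x) (pairing s x) (pairing u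
  x).
move: (det w s) (det p w); clear.
move=> i' j' hw' hp' hs' hu' X Y Z -> px sx xu ij t0 H1 H2.
move: px sx xu ij t0 H1 H2.
rewrite -[hw' <= _ + i' * _](ler_int R) -[hw' <= _](ler_int R) -[0 <= _](ler0z R).
rewrite -!(lerz0 R) !(intrD, intrM, intrN).
move: (i'%:~R) (j'%:~R) (hw'%:~R) (hp'%:~R) (hs'%:~R) (hu'%:~R).
move=> i j hw hp hs hu px sx xu ij t0 H1 H2.
rewrite -?opprD in t0 H1 H2.
set t := hu - (hp + hs) in t0 H1 H2.
(* Since [m <= 0], the slack at [w] splits into three nonnegative terms: [(i - m)] and [(j - m)]
   times the slacks at [p] and [s], and [- m] times the slack of the third side of the triangle. *)
pose m := Num.min i j.
have m0 : m <= 0 by rewrite /m ge_min.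
have mi : m <= i by rewrite /m ge_min lexx.
have mj : m <= j by rewrite /m ge_min lexx orbT.
have H : hw <= i * hp + j * hs + m * t.
  by rewrite /m minEle; case: ifP.
have K1 : 0 <= (i - m) * (X - hp) by rewrite mulr_ge0// subr_ge0.
have K2 : 0 <= (j - m) * (Y - hs) by rewrite mulr_ge0// subr_ge0.
have K3 : 0 <= - m * (t - (X - hp) - (Y - hs)).
  by rewrite mulr_ge0 ?oppr_ge0// /t; lra.
by lra.
Qed.

Lemma contract_region_disj (R : realDomainType) U u h (x : R * R) : uniq U -> u \in U ->
  support_ineqs (rem u U) h x <-> support_ineqs U h x \/ (support_ineqs (rem u U) h x
    /\ pairing u x < (h u)%:~R).
Proof.
move=> Uu uU; split=> [Q|[Q|[]//]].
  have [lt|le] := ltP (pairing u x) (h u)%:~R; [by right|left=> w wU].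
  have [->//|nwu] := eqVneq w u.
  by apply: Q; rewrite (mem_rem_uniq _ Uu) inE nwu.
by move=> w /mem_rem; exact: Q.
Qed.

(** * Lattice points arranged in columns *)

Definition lattice_col (a b : int * int) (al be : int) (f : nat -> nat) n :
  seq (int * int) :=
  [seq ((al + ij.1%:Z) * b.2 - (be + ij.2%:Z) * a.2,
        (be + ij.2%:Z) * a.1 - (al + ij.1%:Z) * b.1)
   | ij <- [seq (i, j) | i <- iota 0 n, j <- iota 0 (f i)]].

Lemma pairing_int u (x : int * int) : pairing u x = u.1 * x.1 + u.2 * x.2.
Proof. by rewrite /pairing !intz. Qed.

(** Cramer's rule. The solution is integral because the determinant is 1, which is what smoothness
    of a cone provides. *)
Lemma lattice_col_pairing a b X Y : det a b = 1 ->
  pairing a (X * b.2 - Y * a.2, Y * a.1 - X * b.1) = X /\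
  pairing b (X * b.2 - Y * a.2, Y * a.1 - X * b.1) = Y.
Proof.
rewrite !pairing_int /det => D /=; split.
  by rewrite -[RHS]mul1r -D; ring.
by rewrite -[RHS]mul1r -D; ring.
Qed.

Lemma size_lattice_col a b al be f n :
  size (lattice_col a b al be f n) = (\sum_(i < n) f i)%N.
Proof.
rewrite size_map size_allpairs_dep -(big_mkord xpredT f) /index_iota subn0.
elim: (iota 0 n) => [|i l IH]; first by rewrite big_nil.
by rewrite big_cons /= IH size_iota.
Qed.

Lemma lattice_col_uniq a b al be f n : det a b = 1 -> uniq (lattice_col a b al be f n).
Proof.
move=> D; rewrite map_inj_uniq.
  apply: allpairs_uniq_dep => [|i _|]; rewrite ?iota_uniq//.
  by case=> i j [k l] _ _ /= [-> ->].
move=> [i j] [k l] /= E.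
have [E1 E2] := lattice_col_pairing (al + i%:Z) (be + j%:Z) D.
have [E3 E4] := lattice_col_pairing (al + k%:Z) (be + l%:Z) D.
rewrite E E3 in E1; rewrite E E4 in E2.
by congr pair; lia.
Qed.

Lemma mem_lattice_col a b al be f n x : det a b = 1 ->
  (x \in lattice_col a b al be f n) =
  [&& al <= pairing a x, pairing a x < al + n%:Z, be <= pairing b x &
     pairing b x < be + (f `|pairing a x - al|%N)%:Z].
Proof.
move=> D; apply/mapP/and4P => [[[i j] /allpairsPdep[i' [j' []]]]|[ax xa bx xb]].
  rewrite !mem_iota /= !add0n => lti ltj [-> ->] ->.
  have [-> ->] := lattice_col_pairing (al + i'%:Z) (be + j'%:Z) D.
  have -> : absz (al + i'%:Z - al)%R = i' by lia.
  by split; lia.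
exists (`|pairing a x - al|%N, `|pairing b x - be|%N).
  apply/allpairsPdep; exists `|pairing a x - al|%N, `|pairing b x - be|%N; split=> //.
  - by rewrite mem_iota /=; lia.
  - by rewrite mem_iota /=; lia.
rewrite /= (_ : al + _ = pairing a x); last by lia.
rewrite (_ : be + _ = pairing b x); last by lia.
move: x D {ax xa bx xb} => [x y]; rewrite !pairing_int /det /= => D.
by congr pair; rewrite -[LHS]mul1r -D; ring.
Qed.

Local Open Scope classical_set_scope.
Local Open Scope ring_scope.

(** * Areas *)

Section area.
Context {R : realType}.
Local Notation mu := (@lebesgue_measure R).
Local Notation T := (measurableTypeR R).
Local Notation TT := (T * T)%type.

Lemma lebesgue_measure_translation (c : R) (A : set T) : measurable A ->
  mu ((fun y : T => (y + c : T)) @^-1` A) = mu A.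
Proof.
move=> mA.
have mf : measurable_fun [set: T] (fun y : T => (y + c : T)).
  exact: measurable_realfun.measurable_funD.
pose m : {measure set T -> \bar R} := pushforward mu (fun y : T => (y + c : T)).
apply/esym; rewrite -[RHS]/(m mf A); apply: lebesgue_measure_unique => //= _ [[a b]] _ <-.
rewrite /m /pushforward.
rewrite (_ : _ @^-1` _ = `](a - c)%R, (b - c)%R]%classic); last first.
  by apply/seteqP; split=> x /=; rewrite !in_itv/= ltrBlDr lerBrDr.
rewrite !lebesgue_measure_itv/= !lte_fin ltrD2r.
by case: ifP => // _; congr EFin; ring.
Qed.

Lemma area_sections (A : set TT) : area A = (\int[mu]_x mu (xsection A x))%E.
Proof. by []. Qed.

Lemma area_ysections (A : set TT) : measurable A ->
  area A = (\int[mu]_y mu (ysection A y))%E.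
Proof.
move=> mA; rewrite /area.
rewrite (product_measure_unique (m' := product_measure2 mu mu))//.
by move=> B C mB mC; rewrite /= product_measure2E.
Qed.

Definition vshear (c : R) (x : TT) : TT := (x.1, x.2 + c * x.1).
Definition hshear (c : R) (x : TT) : TT := (x.1 + c * x.2, x.2).

Lemma measurable_vshear c : measurable_fun [set: TT] (vshear c).
Proof.
apply/measurable_fun_pairP; split => /=; first exact: measurable_fst.
by apply: measurable_realfun.measurable_funD;
  [exact: measurable_snd|apply: measurable_realfun.measurable_funM => //;
    exact: measurable_fst].
Qed.

Lemma measurable_hshear c : measurable_fun [set: TT] (hshear c).
Proof.
apply/measurable_fun_pairP; split => /=; last exact: measurable_snd.
by apply: measurable_realfun.measurable_funD;
  [exact: measurable_fst|apply: measurable_realfun.measurable_funM => //;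
    exact: measurable_snd].
Qed.

Lemma area_vshear c (A : set TT) : measurable A -> area (vshear c @^-1` A) = area A.
Proof.
move=> mA; rewrite !area_sections; apply: eq_integral => x _.
rewrite -(lebesgue_measure_translation (c * x) (measurable_xsection x mA)).
by congr (mu _); apply/seteqP; split=> y /=; rewrite /xsection/= !inE.
Qed.

Lemma area_hshear c (A : set TT) : measurable A -> area (hshear c @^-1` A) = area A.
Proof.
move=> mA; rewrite !area_ysections//; last first.
  by rewrite -[X in measurable X]setTI; apply: measurable_hshear.
apply: eq_integral => y _.
rewrite -(lebesgue_measure_translation (c * y) (measurable_ysection y mA)).
by congr (mu _); apply/seteqP; split=> x /=; rewrite /ysection/= !inE.
Qed.

Definition linmap (a b : R * R) (x : TT) : TT := (dot a x, dot b x).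

Lemma measurable_dot (a : R * R) : measurable_fun [set: TT] (dot a : TT -> T).
Proof.
by apply: measurable_realfun.measurable_funD; apply: measurable_realfun.measurable_funM.
Qed.

Lemma measurable_linmap a b : measurable_fun [set: TT] (linmap a b).
Proof. by apply/measurable_fun_pairP; split; exact: measurable_dot. Qed.

(** A matrix of determinant 1 with nonzero upper right entry is a product of three shears, and a
    shear preserves area by Fubini and translation invariance on the line. If that entry vanishes,
    composing with one horizontal shear makes it nonzero. *)
Lemma area_linmap a b (A : set TT) : a.1 * b.2 - a.2 * b.1 = 1 -> measurable A ->
  area (linmap a b @^-1` A) = area A.
Proof.
move: a b => [a1 a2] [b1 b2] /=.
have main c1 c2 d1 d2 (B : set TT) : c1 * d2 - c2 * d1 = 1 -> c2 != 0 -> measurable B ->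
    area (linmap (c1, c2) (d1, d2) @^-1` B) = area B.
  move=> D nz mB.
  pose f := vshear ((d2 - 1) / c2); pose g := hshear c2; pose h := vshear ((c1 - 1) / c2).
  have -> : linmap (c1, c2) (d1, d2) @^-1` B = h @^-1` (g @^-1` (f @^-1` B)).
    suff E x : linmap (c1, c2) (d1, d2) x = f (g (h x)) by apply/seteqP; split=> x /=;
      rewrite E.
    have -> : d1 = (c1 * d2 - 1) / c2 by rewrite -D; field.
    by rewrite /linmap /f /g /h /dot/vshear/hshear/=; congr pair; field.
  have mf : measurable (f @^-1` B).
    by rewrite -[X in measurable X]setTI; apply: measurable_vshear.
  have mg : measurable (g @^-1` (f @^-1` B)).
    by rewrite -[X in measurable X]setTI; apply: measurable_hshear.
  by rewrite area_vshear// area_hshear// area_vshear.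
move=> D mA; have [a20|] := eqVneq a2 0; last by move=> ?; exact: main.
have a1nz : a1 != 0 by apply/eqP => a10; move: D; rewrite a20 a10 !mul0r subrr => /eqP;
  rewrite eq_sym oner_eq0.
rewrite -(area_hshear 1); last first.
  by rewrite -[X in measurable X]setTI; apply: measurable_linmap.
have -> : hshear 1 @^-1` (linmap (a1, a2) (b1, b2) @^-1` A) = linmap (a1, a1) (b1,
  b1 + b2) @^-1` A.
  by rewrite a20; apply/seteqP; split=> x; rewrite /linmap/hshear/dot/=; congr A;
    congr pair; ring.
by rewrite main//; rewrite -D a20; ring.
Qed.

Lemma integral_affine (m q x0 x1 : R) : x0 <= x1 ->
  (\int[mu]_(x in `[x0, x1]) (m * x + q)%:E)%E = ((x1 - x0) * (m * (x0 + x1) / 2 + q))%:E.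
Proof.
rewrite le_eqVlt => /predU1P[->|lt01].
  by rewrite set_itv1 integral_set1 subrr mul0r.
pose p : {poly R} := (m / 2)%:P * 'X^2 + q%:P * 'X.
have pE x : p.[x] = m / 2 * x ^+ 2 + q * x by rewrite /p !hornerE.
have p'E x : p^`().[x] = m * x + q.
  by rewrite /p !poly.derivE !hornerE /=; field.
pose F := horner p.
have dF x : is_derive x (1 : R) F (m * x + q) by rewrite -p'E; exact: is_derive_poly.
transitivity ((F x1)%:E - (F x0)%:E)%E; last by rewrite -EFinB /F !pE; congr EFin; field.
apply: (@continuous_FTC2 _ (fun x => m * x + q) F) => //.
- apply: continuous_subspaceT => x; apply: cvgD; last exact: cvg_cst.
  by apply: cvgM; [exact: cvg_cst|exact: cvg_id].
- have cF x : {for x, continuous F}.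
    by apply: differentiable_continuous; apply/derivable1_diffP; apply: ex_derive.
  split=> [x _|//|//]; first exact: ex_derive.
  + exact/cvg_at_right_filter/cF.
  + exact/cvg_at_left_filter/cF.
- by move=> x _; rewrite derive1E; apply: derive_val.
Qed.

Lemma area_strip (A : set TT) (m q x0 x1 : R) : x0 <= x1 ->
  (forall x, x0 <= x <= x1 -> mu (xsection A x) = (m * x + q)%:E) ->
  (forall x, ~~ (x0 <= x <= x1) -> xsection A x = set0) ->
  area A = ((x1 - x0) * (m * (x0 + x1) / 2 + q))%:E.
Proof.
move=> le01 H1 H2; rewrite area_sections -integral_affine// [RHS]integral_mkcond.
apply: eq_integral => x _; rewrite /patch; case: ifPn => [/set_mem|/negP nx].
  by rewrite /= in_itv /=; exact: H1.
by rewrite H2 ?measure0//; apply/negP => K; apply: nx; rewrite inE /= in_itv.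
Qed.

End area.

(** Doubled to avoid a division in [int]; the hypothesis makes [absz] harmless. *)
Lemma sum_arith (F0 c : int) n : (forall i, (i < n)%N -> 0 <= F0 + c * i%:Z) ->
  2 * (\sum_(i < n) absz (F0 + c * i%:Z)%R)%N%:Z = 2 * n%:Z * F0 + c * n%:Z * (n%:Z - 1).
Proof.
elim: n => [|n IH] H; first by rewrite big_ord0; lia.
rewrite big_ord_recr /= PoszD mulrDr IH; last by move=> i lin; apply: H; exact: ltnW.
have := H n (leqnn _); set z := F0 + _ => z0.
have -> : (`|z|%N)%:Z = z by lia.
by rewrite /z intS; ring.
Qed.

Lemma lattice_col_arith a b (al be F0 c : int) (n : nat) : det a b = 1 ->
  (forall i, (i < n)%N -> 0 <= F0 + c * i%:Z) ->
  exists s : seq (int * int), [/\ uniq s,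
    (forall x, (x \in s) = [&& al <= pairing a x, pairing a x < al + n%:Z,
      be <= pairing b x &
        pairing b x < be + F0 + c * (pairing a x - al)]) &
    2 * (size s)%:Z = 2 * n%:Z * F0 + c * n%:Z * (n%:Z - 1)].
Proof.
move=> D H; exists (lattice_col a b al be (fun i => absz (F0 + c * i%:Z)%R) n).
split; first exact: lattice_col_uniq.
- move=> x; rewrite mem_lattice_col//; apply/and4P/and4P => -[H1 H2 H3 H4]; split=> //.
  + have E : (`|pairing a x - al|%N)%:Z = pairing a x - al by lia.
    have := H (absz (pairing a x - al)%R); rewrite E => /(_ ltac:(lia)) K.
    by move: H4; rewrite E; move: K; move: (c * _) => z; lia.
  + have E : (`|pairing a x - al|%N)%:Z = pairing a x - al by lia.
    have := H (absz (pairing a x - al)%R); rewrite E => /(_ ltac:(lia)) K.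
    by move: H4; move: K; move: (c * _) => z; lia.
- by rewrite size_lattice_col sum_arith.
Qed.

Section core.
Context {R : realType}.
Local Notation mu := (@lebesgue_measure R).
Local Notation T := (measurableTypeR R).
Local Notation TT := (T * T)%type.

Definition lattice_vec (u : int * int) : R * R := (u.1%:~R, u.2%:~R).

Definition floor_vec (x : R * R) : int * int := (Num.floor x.1, Num.floor x.2).

Lemma lattice_floor (x : R * R) : lattice x -> lattice_vec (floor_vec x) = x.
Proof.
case; rewrite !intrEfloor /lattice_vec /= => /eqP-> /eqP->.
by rewrite -surjective_pairing.
Qed.

Lemma pairing_dot u (x : R * R) : pairing u x = dot (lattice_vec u) x.
Proof. by []. Qed.

Lemma measurable_halfplane (u : R * R) (c : R) : measurable [set x : TT | c <= dot u x].
Proof.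
rewrite (_ : [set _ | _] = (dot u : TT -> T) @^-1` `[c, +oo[%classic).
  by rewrite -[X in measurable X]setTI; apply: measurable_dot => //;
    exact: measurable_itv.
by apply/seteqP; split=> x /=; rewrite in_itv /= andbT.
Qed.

Lemma measurable_open_halfplane (u : R * R) (c : R) : measurable [set x : TT | dot u x
  < c].
Proof.
rewrite (_ : [set _ | _] = ~` [set x : TT | c <= dot u x]).
  by apply: measurableC; exact: measurable_halfplane.
by apply/seteqP; split=> x /=; rewrite ltNge => /negP.
Qed.

Definition support_polygon U h : set TT := [set x | support_ineqs U h x].

Lemma measurable_support_polygon U h : measurable (support_polygon U h).
Proof.
elim: U => [|u U IH].
  by rewrite (_ : support_polygon _ _ = setT)//; apply/seteqP; split.
rewrite (_ : support_polygon _ _ = [set x : TT | (h u)%:~R <= dot (lattice_vec u) x]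
  `&` support_polygon U h).
  by apply: measurableI => //; exact: measurable_halfplane.
apply/seteqP; split=> x /=.
  move=> Q; split; first by rewrite -pairing_dot; apply: Q; rewrite mem_head.
  by move=> w wU; apply: Q; rewrite inE wU orbT.
by move=> [Qu Q] w; rewrite inE => /predU1P[->|/Q].
Qed.

Lemma area_unimodular a b (S : set TT) : det a b = 1 -> measurable S ->
  area [set x : TT | S (pairing a x, pairing b x)] = area S.
Proof.
move=> D mS; rewrite -(@area_linmap _ (lattice_vec a) (lattice_vec b) S)//.
by rewrite /= -!intrM -intrB; move: D; rewrite /det => ->.
Qed.

Lemma area_trapezoid (x0 x1 y0 m q : R) : x0 <= x1 -> y0 <= m * x0 + q ->
  y0 <= m * x1 + q ->
  area [set x : TT | [/\ x0 <= x.1, x.1 <= x1, y0 <= x.2 & x.2 <= m * x.1 + q]] =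
  ((x1 - x0) * (m * (x0 + x1) / 2 + (q - y0)))%:E.
Proof.
move=> le01 H0 H1; apply: area_strip => // [x /andP[x0x xx1]|x nx].
  rewrite (_ : xsection _ x = `[y0, m * x + q]%classic); last first.
    apply/seteqP; split=> y /=; rewrite /xsection/= inE /= in_itv /=.
      by case=> _ _ -> ->.
    by move=> /andP[].
  rewrite lebesgue_measure_itv /= lte_fin.
  have H : y0 <= m * x + q.
    have [m0|m0] := leP 0 m.
      by apply: le_trans H0 _; rewrite lerD2r ler_wpM2l.
    by apply: le_trans H1 _; rewrite lerD2r ler_wnM2l// ltW.
  case: ltP => [_|K]; first by rewrite -EFinB; congr EFin; ring.
  by congr EFin; lra.
apply/seteqP; split=> // y /=; rewrite /xsection/= inE /= => -[a b _ _].
by move: nx; rewrite a b.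
Qed.

Lemma area_triangle (x0 y0 t : R) : 0 <= t ->
  area [set x : TT | [/\ x0 <= x.1, y0 <= x.2 & x.1 + x.2 < x0 + y0 + t]] = (t ^+ 2 /
    2)%:E.
Proof.
move=> t0; rewrite (@area_strip _ _ (-1) (x0 + t) x0 (x0 + t)).
- by congr EFin; field.
- lra.
- move=> x /andP[x0x xx1].
  rewrite (_ : xsection _ x = `[y0, x0 + y0 + t - x[%classic); last first.
    apply/seteqP; split=> y /=; rewrite /xsection/= inE /= in_itv /=.
      by case=> _ -> lt; lra.
    by move=> /andP[y0y lt]; split=> //; lra.
  rewrite lebesgue_measure_itv /= lte_fin.
  case: ltP => [_|K]; first by rewrite -EFinB; congr EFin; ring.
  by congr EFin; lra.
- move=> x nx; apply/seteqP; split=> // y /=; rewrite /xsection/= inE /= => -[a b lt].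
  by move: nx; rewrite a /= -ltNge; lra.
Qed.
End core.

(** * The area formula for globally nef data on a fan *)

Section core.
Context {R : realType}.
Local Notation T := (measurableTypeR R).
Local Notation TT := (T * T)%type.

Definition adjoint_support (h : int * int -> int) u := h u + 1.

(** Real values of the areas and an explicit list of the lattice points are part of the statement,
    so that the induction needs neither infinite measures nor cardinals of sets. *)
Definition adjoint_formula U (h : int * int -> int) :=
  exists (A A' : R) (s : seq (int * int)),
  [/\ area (support_polygon U h : set TT) = A%:E,
    area (support_polygon U (adjoint_support h) : set TT) = A'%:E,
    uniq s, (forall x : int * int, x \in s <-> support_ineqs U (adjoint_support h) x) &
    A + A' = 2 * (size s)%:R + 4 - (size U)%:R / 2].

Lemma area_contract U p u s h : fan U -> p \in U -> u \in U -> s \in U ->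
  adj U p u -> adj U u s -> det p s = 1 -> globally_nef U h ->
  area (support_polygon (rem u U) h : set TT) =
  (area (support_polygon U h : set TT) + ((h u - (h p + h s))%:~R ^+ 2 / 2 : R)%:E)%E.
Proof.
move=> fU pU uU sU pu us ps nef.
have t0 := contract_nef_ge0 pU uU sU pu us ps nef.
pose S : set TT := [set x : TT | [/\ (h p)%:~R <= x.1, (h s)%:~R <= x.2 &
  x.1 + x.2 < (h p)%:~R + (h s)%:~R + (h u - (h p + h s))%:~R]].
have SE (x : TT) : S x <-> [/\ (h p)%:~R <= x.1,
  (h s)%:~R <= x.2 & x.1 + x.2 < (h u)%:~R].
  suff -> : (h u)%:~R = (h p)%:~R + (h s)%:~R + (h u - (h p + h s))%:~R :> R by [].
  by rewrite intrB intrD; ring.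
have QE : support_polygon (rem u U) h = support_polygon U h `|` [set x : TT | S
  (pairing p x, pairing s x)].
  apply/seteqP; split=> x.
    move/(contract_region_disj (R := R) h x (proj1 fU) uU) => [|H]; [by left|right].
    by apply/SE; apply/(contract_region x fU pU uU sU pu us ps nef).
  move=> H; apply/(contract_region_disj (R := R) h x (proj1 fU) uU).
  case: H => [|/SE]; [by left|right].
  by apply/(contract_region x fU pU uU sU pu us ps nef).
have mS : measurable S.
  have -> : S = [set x : TT | (h p)%:~R <= dot (1,
    0) x] `&` ([set x : TT | (h s)%:~R <= dot (0, 1) x] `&`
      [set x : TT | dot (1, 1) x < (h u)%:~R]).
    apply/seteqP; split=> x; rewrite /= /dot /= !mul1r !mul0r addr0 add0r.
      by move/SE => -[].
    by move=> [a [b c]]; apply/SE.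
  by apply: measurableI; [|apply: measurableI];
    [exact: measurable_halfplane|exact: measurable_halfplane|exact:
      measurable_open_halfplane].
have mS' : measurable [set x : TT | S (pairing p x, pairing s x)].
  rewrite -[X in measurable X]setTI.
  exact: (@measurable_linmap R (lattice_vec p) (lattice_vec s)).
rewrite QE; transitivity (area (support_polygon U h) + area [set x : TT | S (pairing p
  x, pairing s x)])%E.
  apply: measureU => //; first exact: measurable_support_polygon.
  apply/seteqP; split=> // x [/= Q /SE].
  move/(contract_region x fU pU uU sU pu us ps nef) => [_].
  by rewrite ltNge Q.
congr (_ + _)%E; rewrite area_unimodular// area_triangle// ler0z.
exact: t0.
Qed.

(** Applied to [adjoint_support h], whose difference at [u] is [t - 1] when that of [h] is [t]; the
    product then becomes [(t - 1) * t]. *)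
Lemma count_contract U p u s h (l : seq (int * int)) :
  fan U -> p \in U -> u \in U -> s \in U ->
  adj U p u -> adj U u s -> det p s = 1 -> globally_nef U h ->
  uniq l -> (forall x : int * int, x \in l <-> support_ineqs (rem u U) h x) ->
  exists l' : seq (int * int), [/\ uniq l',
    (forall x : int * int, x \in l' <-> support_ineqs U h x) &
    2 * (size l)%:Z = 2 * (size l')%:Z + (h u - (h p + h s)) * (h u - (h p + h s) + 1)].
Proof.
move=> fU pU uU sU pu us ps nef ul lP.
have t0 := contract_nef_ge0 pU uU sU pu us ps nef.
pose g (x : int * int) := h u <= pairing u x.
exists [seq x <- l | g x]; split; first exact: filter_uniq.
  move=> x; rewrite mem_filter; split=> [/andP[gx /lP Q]|Q].
    move=> w wU; have [->|nwu] := eqVneq w u; first by rewrite intz.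
    by apply: Q; rewrite (mem_rem_uniq _ (proj1 fU)) inE nwu.
  apply/andP; split; first by have := Q _ uU; rewrite intz.
  by apply/lP/(contract_region_disj h x (proj1 fU) uU); left.
set t := h u - _ in t0 *.
(* The points lost form columns of heights [t, t - 1, ..., 1]. *)
have [s' [us' ms' ss']] := @lattice_col_arith p s (h p) (h s) t (-1) `|t|%N ps
  ltac:(move=> i; lia).
have sz : size [seq x <- l | ~~ g x] = size s'.
  apply/perm_size/uniq_perm => [|//|x]; first exact: filter_uniq.
  rewrite mem_filter ms'; apply/andP/and4P.
    move=> [/negP gx /lP Q].
    have [|] := (proj1 (contract_region x fU pU uU sU pu us ps nef)).
      by split=> //; rewrite intz ltNge; apply/negP.
    rewrite !intz => H1 H2 H3; split=> //; rewrite /t in t0 *; lia.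
  move=> [H1 H2 H3 H4].
  have [] := (proj2 (contract_region x fU pU uU sU pu us ps nef)).
    by rewrite !intz; split=> //; rewrite /t in H4; lia.
  by move=> Q; rewrite intz /g -ltNge => ->; split=> //; apply/lP.
have -> : size l = (size [seq x <- l | g x] + size s')%N.
  by rewrite -sz !size_filter count_predC.
rewrite PoszD mulrDr ss'; congr (_ + _).
have -> : (`|t|%N)%:Z = t by lia.
ring.
Qed.

Lemma adjoint_formula_step U p u s h : fan U -> p \in U -> u \in U -> s \in U ->
  adj U p u -> adj U u s -> det p s = 1 -> globally_nef U h ->
    globally_nef U (adjoint_support h) ->
  adjoint_formula (rem u U) h -> adjoint_formula U h.
Proof.
move=> fU pU uU sU pu us ps nef nef1 [A [A' [l [a a' ul lP F]]]].
have [l' [ul' lP' sz]] := count_contract fU pU uU sU pu us ps nef1 ul lP.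
have E := area_contract fU pU uU sU pu us ps nef; rewrite a in E.
have E' := area_contract fU pU uU sU pu us ps nef1; rewrite a' in E'.
exists (A - (h u - (h p + h s))%:~R ^+ 2 / 2),
  (A' - (adjoint_support h u - (adjoint_support h p + adjoint_support h s))%:~R ^+ 2 /
    2), l'.
split=> //.
- by rewrite EFinB E addeK.
- by rewrite EFinB E' addeK.
have U0 : (0 < size U)%N by case: (U) uU.
move: F; rewrite size_rem// -subn1 natrB//.
have -> : (size l)%:R = (size l)%:Z%:~R :> R by [].
have -> : (size l')%:R = (size l')%:Z%:~R :> R by [].
move/(congr1 (fun z : int => z%:~R : R)): sz.
rewrite /adjoint_support !(intrD, intrM, intrB).
lra.
Qed.

End core.

(** * The two base cases as trapezoids *)

Lemma affine_ge (K : realDomainType) (y0 m q x0 x1 x : K) :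
  x0 <= x -> x <= x1 -> y0 <= m * x0 + q -> y0 <= m * x1 + q -> y0 <= m * x + q.
Proof.
move=> H0 H1 K0 K1; have [m0|m0] := leP 0 m.
  by apply: le_trans K0 _; rewrite lerD2r ler_wpM2l.
by apply: le_trans K1 _; rewrite lerD2r ler_wnM2l// ltW.
Qed.

Section core.
Context {R : realType}.
Local Notation T := (measurableTypeR R).
Local Notation TT := (T * T)%type.

(** The common shape of both base cases. For the projective plane the slope is -1 and the right side
    shrinks to the point where top and bottom meet; for a Hirzebruch surface the slope is the [c] of
    [fan_ind]. *)
Definition trapezoid (K : realDomainType) a b (x0 x1 y0 m q : K) (x : K * K) :=
  [&& x0 <= pairing a x, pairing a x <= x1, y0 <= pairing b x & pairing b x <= m *
    pairing a x + q].

Lemma area_trapezoid_unimodular a b (x0 x1 y0 m q : R) : det a b = 1 ->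
  x0 <= x1 -> y0 <= m * x0 + q -> y0 <= m * x1 + q ->
  area [set x : TT | trapezoid a b x0 x1 y0 m q x] =
  ((x1 - x0) * (m * (x0 + x1) / 2 + (q - y0)))%:E.
Proof.
move=> D H H0 H1; rewrite -(area_trapezoid H H0 H1) -[RHS](area_unimodular D).
  by congr area; apply/seteqP; split=> x /=; [move/and4P|move=> ?; apply/and4P].
rewrite (_ : [set _ | _] = [set x : TT | x0 <= dot (1, 0) x] `&`
  ([set x : TT | - x1 <= dot (-1, 0) x] `&` ([set x : TT | y0 <= dot (0, 1) x] `&`
   [set x : TT | - q <= dot (m, -1) x]))).
  by do 3! [apply: measurableI; first exact: measurable_halfplane];
    exact: measurable_halfplane.
apply/seteqP; split=> x; rewrite /dot /=.
  by case=> ? ? ? ?; do 3! [split; first lra]; lra.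
by case=> ? [? [? ?]]; split; lra.
Qed.

Lemma trapezoid_lattice a b (x0 x1 y0 m q : int) : det a b = 1 ->
  x0 <= x1 -> y0 <= m * x0 + q -> y0 <= m * x1 + q ->
  exists s : seq (int * int), [/\ uniq s, (forall x,
    (x \in s) = trapezoid a b x0 x1 y0 m q x) &
    2 * (size s)%:Z = (x1 - x0 + 1) * (2 * (m * x0 + q - y0 + 1) + m * (x1 - x0))].
Proof.
move=> D H H0 H1; pose n := absz (x1 - x0 + 1).
have nE : n%:Z = x1 - x0 + 1 by rewrite /n; lia.
have [|s [us ms ss]] := @lattice_col_arith a b x0 y0 (m * x0 + q - y0 + 1) m n D.
  move=> i lin; have K0 : x0 <= x0 + i%:Z by lia.
  have K1 : x0 + i%:Z <= x1 by lia.
  by have := affine_ge K0 K1 H0 H1; rewrite mulrDr; move: (m * x0) (m * i%:Z) => y z; lia.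
exists s; split=> //.
  move=> x; rewrite ms /trapezoid nE mulrBr; move: (m * x0) (m * pairing a x) (pairing
    a x) (pairing b x) => y z X Y; lia.
by rewrite ss nE; ring.
Qed.

(** Both areas and the number of points are polynomials in the six integers. The last hypothesis is
    the identity between them; it is left to the two cases, which differ in [x1'] and in the number
    of rays. *)
Lemma adjoint_formula_trapezoid U h a b (x1 x1' c hs : int) : det a b = 1 ->
  (forall x : R * R, support_ineqs U h x <-> trapezoid a b (h a)%:~R x1%:~R (h b)%:~R
    c%:~R hs%:~R x) ->
  (forall x : R * R, support_ineqs U (adjoint_support h) x <->
     trapezoid a b (h a + 1)%:~R x1'%:~R (h b + 1)%:~R c%:~R (hs - 1)%:~R x) ->
  (forall x : int * int, support_ineqs U (adjoint_support h) x <->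
     trapezoid a b (h a + 1) x1' (h b + 1) c (hs - 1) x) ->
  [/\ h a <= x1, h b <= c * h a + hs & h b <= c * x1 + hs] ->
  [/\ h a + 1 <= x1', h b + 1 <= c * (h a + 1) + (hs - 1) & h b + 1 <= c * x1' + (hs -
    1)] ->
  (forall (X0 X1 X1' Y0 C Q : R), X0 = (h a)%:~R -> X1 = x1%:~R -> X1' = x1'%:~R ->
    Y0 = (h b)%:~R -> C = c%:~R -> Q = hs%:~R ->
    (X1 - X0) * (C * (X0 + X1) / 2 + (Q - Y0)) +
    (X1' - (X0 + 1)) * (C * (X0 + 1 + X1') / 2 + (Q - 1 - (Y0 + 1))) =
    (X1' - X0) * (2 * (C * (X0 + 1) + Q - Y0 - 1) + C * (X1' - X0 - 1)) + 4 - (size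
      U)%:R / 2) ->
  adjoint_formula (R := R) U h.
Proof.
move=> D QE QE' QI [H H0 H1] [K K0 K1] F.
have [s [us ms ss]] := trapezoid_lattice D K K0 K1.
pose X0 : R := (h a)%:~R; pose X1 : R := x1%:~R; pose X1' : R := x1'%:~R.
pose Y0 : R := (h b)%:~R; pose C : R := c%:~R; pose Q : R := hs%:~R.
exists ((X1 - X0) * (C * (X0 + X1) / 2 + (Q - Y0))).
exists ((X1' - (X0 + 1)) * (C * (X0 + 1 + X1') / 2 + (Q - 1 - (Y0 + 1)))), s.
split=> //.
- rewrite -(area_trapezoid_unimodular D); first by congr area; apply/seteqP; split=> x;
  rewrite /support_polygon /= => /QE.
  + by rewrite ler_int.
  + by rewrite -intrM -intrD ler_int.
  + by rewrite -intrM -intrD ler_int.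
- have <- : (h a + 1)%:~R = X0 + 1 by rewrite intrD.
  have <- : (h b + 1)%:~R = Y0 + 1 by rewrite intrD.
  have <- : (hs - 1)%:~R = Q - 1 by rewrite intrB.
  rewrite -(area_trapezoid_unimodular D); first by congr area; apply/seteqP; split=> x;
    rewrite /support_polygon /= => /QE'.
  + by rewrite ler_int.
  + by rewrite -intrM -intrD ler_int.
  + by rewrite -intrM -intrD ler_int.
- by move=> x; rewrite ms; split=> /QI.
rewrite (F _ _ _ _ _ _ erefl erefl erefl erefl erefl erefl); congr (_ + _ - _).
rewrite -[(size s)%:R]/((size s)%:Z%:~R) -[2]/(2%:~R) -intrM ss.
by rewrite /X0 /X1' /Q /Y0 /C !(intrD, intrM, intrB); ring.
Qed.

Lemma support_ineqs_perm (K : realDomainType) U V h (x : K * K) : perm_eq U V ->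
  support_ineqs U h x <-> support_ineqs V h x.
Proof. by move=> /perm_mem E; split=> Q u uU; apply: Q; rewrite ?E// -E. Qed.

Lemma adjoint_formula3 U h p u s : s = comb (-1) (-1) p u ->
  adj U p u -> adj U u s -> adj U s p -> perm_eq U [:: p; u; s] ->
  globally_nef U h -> globally_nef U (adjoint_support h) -> adjoint_formula (R := R) U h.
Proof.
move=> sE pu us sp UE nef nef1; have D := adj_det pu.
have mU := perm_mem UE.
have [pU uU sU] : [/\ p \in U, u \in U & s \in U] by rewrite !mU !inE !eqxx !orbT.
have := nef _ _ pU uU pu _ sU; have := nef1 _ _ pU uU pu _ sU;
  rewrite sE !detE D -sE /adjoint_support => G1 G.
(* As [p = - s - u], the right end is where the inequalities of [s] and [u] are both tight; raising
   [h] by 1 at both moves it by 2. *)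
apply: (@adjoint_formula_trapezoid U h p u (- h s - h u) (- h s - h u - 2) (-1) (- h
  s)) => //.
- move=> x; rewrite (support_ineqs_perm _ _ UE) /trapezoid.
  have zs : pairing s x = - pairing p x - pairing u x by rewrite sE pairing_comb; ring.
  split=> [Q|/and4P[H1 H2 H3 H4] w].
    have := Q s; have := Q p; have := Q u; rewrite !inE !eqxx !orbT zs =>
      /(_ isT) Q1 /(_ isT) Q2 /(_ isT) Q3.
    by rewrite intrB intrN; apply/and4P; split; lra.
  rewrite !inE => /or3P[]/eqP-> //; rewrite zs; move: H4; rewrite intrN; lra.
- move=> x; rewrite (support_ineqs_perm _ _ UE) /trapezoid.
  have zs : pairing s x = - pairing p x - pairing u x by rewrite sE pairing_comb; ring.
  split=> [Q|/and4P[H1 H2 H3 H4] w].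
    have := Q s; have := Q p; have := Q u; rewrite !inE !eqxx !orbT zs /adjoint_support
      => /(_ isT) Q1 /(_ isT) Q2 /(_ isT) Q3.
    by move: Q1 Q2 Q3; rewrite !(intrB, intrN, intrD) => Q1 Q2 Q3; apply/and4P; split;
      lra.
  rewrite !inE => /or3P[]/eqP-> //; rewrite zs; move: H4;
    rewrite /adjoint_support !(intrN, intrB, intrD); lra.
- move=> x; rewrite (support_ineqs_perm _ _ UE) /trapezoid.
  have zs : pairing s x = - pairing p x - pairing u x by rewrite sE pairing_comb !intz;
    ring.
  split=> [Q|/and4P[H1 H2 H3 H4] w].
    have := Q s; have := Q p; have := Q u; rewrite !inE !eqxx !orbT zs /adjoint_support
      !intz => /(_ isT) Q1 /(_ isT) Q2 /(_ isT) Q3.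
    by apply/and4P; split; lia.
  by rewrite !inE => /or3P[]/eqP->; rewrite ?zs /adjoint_support ?intz//; lia.
- by split; lia.
- by split; lia.
- move=> X0 X1 X1' Y0 C Q -> -> -> -> -> ->; rewrite (perm_size UE) /= !(intrB, intrN).
  move: ((h p)%:~R) ((h u)%:~R) ((h s)%:~R) => x y z; by field.
Qed.

Lemma adjoint_formula4 U h p u q s c : q = comb (-1) 0 p u -> s = comb c (-1) p u ->
  adj U p u -> adj U u q -> adj U q s -> adj U s p -> perm_eq U [:: p; u; q; s] ->
  globally_nef U h -> globally_nef U (adjoint_support h) -> adjoint_formula (R := R) U h.
Proof.
move=> qE sE pu uq qs sp UE nef nef1; have D := adj_det pu.
have mU := perm_mem UE.
have [pU uU qU sU] : [/\ p \in U, u \in U, q \in U & s \in U] by rewrite !mU !inE !eqxx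
  !orbT.
have E1 : det q u = -1 by rewrite qE detE D.
have E2 : det p q = 0 by rewrite qE detE D.
have E3 : det s u = c by rewrite sE detE D mulr1.
have E4 : det p s = -1 by rewrite sE detE D.
have E5 : det s q = -1 by rewrite sE qE detE D; ring.
have E6 : det u s = - c by rewrite sE detE D mulr1.
have := nef _ _ pU uU pu _ qU; have := nef _ _ pU uU pu _ sU;
  have := nef _ _ uU qU uq _ sU.
have := nef1 _ _ pU uU pu _ qU; have := nef1 _ _ pU uU pu _ sU;
  have := nef1 _ _ uU qU uq _ sU.
rewrite E1 E2 E3 E4 E5 E6 /adjoint_support => G1 G2 G3 G4 G5 G6.
(* The right side is the inequality of [q = - p] alone, so it moves by 1. *)
apply: (@adjoint_formula_trapezoid U h p u (- h q) (- h q - 1) c (- h s)) => //.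
- move=> x; rewrite (support_ineqs_perm _ _ UE) /trapezoid.
  have zq : pairing q x = - pairing p x by rewrite qE pairing_comb; ring.
  have zs : pairing s x = c%:~R * pairing p x - pairing u x by rewrite sE pairing_comb;
    ring.
  split=> [Q|/and4P[H1 H2 H3 H4] w].
    have := Q s; have := Q q; have := Q p; have := Q u.
    rewrite !inE !eqxx !orbT zs zq => /(_ isT) Q1 /(_ isT) Q2 /(_ isT) Q3 /(_ isT) Q4.
    by rewrite !intrN; apply/and4P; split; lra.
  rewrite !inE => /or4P[]/eqP-> //; rewrite ?zs ?zq; move: H2 H4; rewrite !intrN; lra.
- move=> x; rewrite (support_ineqs_perm _ _ UE) /trapezoid.
  have zq : pairing q x = - pairing p x by rewrite qE pairing_comb; ring.
  have zs : pairing s x = c%:~R * pairing p x - pairing u x by rewrite sE pairing_comb;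
    ring.
  split=> [Q|/and4P[H1 H2 H3 H4] w].
    have := Q s; have := Q q; have := Q p; have := Q u.
    rewrite !inE !eqxx !orbT zs zq /adjoint_support =>
      /(_ isT) Q1 /(_ isT) Q2 /(_ isT) Q3 /(_ isT) Q4.
    by move: Q1 Q2 Q3 Q4; rewrite !(intrB, intrN, intrD) => Q1 Q2 Q3 Q4; apply/and4P;
      split; lra.
  rewrite !inE => /or4P[]/eqP-> //; rewrite ?zs ?zq; move: H2 H4;
    rewrite /adjoint_support !(intrN, intrB, intrD); lra.
- move=> x; rewrite (support_ineqs_perm _ _ UE) /trapezoid.
  have zq : pairing q x = - pairing p x by rewrite qE pairing_comb !intz; ring.
  have zs : pairing s x = c * pairing p x - pairing u x by rewrite sE pairing_comb
    !intz; ring.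
  split=> [Q|/and4P[H1 H2 H3 H4] w].
    have := Q s; have := Q q; have := Q p; have := Q u.
    rewrite !inE !eqxx !orbT zs zq /adjoint_support !intz =>
      /(_ isT) Q1 /(_ isT) Q2 /(_ isT) Q3 /(_ isT) Q4.
    by apply/and4P; split; lia.
  by rewrite !inE => /or4P[]/eqP->; rewrite ?zs ?zq /adjoint_support ?intz//; lia.
- by split; lia.
- by split; lia.
- move=> X0 X1 X1' Y0 C Q -> -> -> -> -> ->; rewrite (perm_size UE) /= !(intrB, intrN).
  move: ((h p)%:~R) ((h u)%:~R) ((h s)%:~R) ((h q)%:~R) (c%:~R) => x y z w v; by field.
Qed.

Theorem fan_adjoint_formula U h : fan U -> U != [::] -> globally_nef U h ->
  globally_nef U (adjoint_support h) ->
  adjoint_formula (R := R) U h.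
Proof.
move=> fU U0; move: h.
apply: (@fan_ind (fun U => forall h, globally_nef U h ->
  globally_nef U (adjoint_support h) ->
  adjoint_formula (R := R) U h)) fU U0 => {}U.
- move=> p u s sE fU pu us sp UE h; exact: adjoint_formula3 sE pu us sp UE.
- move=> p u q s c qE sE fU pu uq qs sp UE h;
  exact: adjoint_formula4 qE sE pu uq qs sp UE.
- move=> p u s fU pU uU sU pu us ps IH h nef nef1.
  apply: (adjoint_formula_step fU pU uU sU pu us ps nef nef1).
  by apply: IH; [apply: (contract_nef fU pU uU sU pu us ps)|apply: (contract_nef fU pU
    uU sU pu us ps)].
Qed.

End core.

(** * Convex hulls in the plane *)

Section convex.
Context {R : realType}.
Implicit Types (x y u : R * R) (C : set (R * R)).

Lemma convex_setP C : @convex_set R (R * R)%type C <->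
  forall x y t, 0 <= t -> t <= 1 -> C x -> C y ->
    C (t * x.1 + (1 - t) * y.1, t * x.2 + (1 - t) * y.2).
Proof.
split=> [H x y t t0 t1 Cx Cy|H x y t /set_mem Cx /set_mem Cy].
  have := H x y (Itv01 t0 t1) (mem_set Cx) (mem_set Cy); move/set_mem.
  by [].
apply/mem_set; exact: (H x y t%:num).
Qed.

(** The weights are not normalised, so that determinants can serve as barycentric coordinates, and
    some of them may vanish. *)
Lemma convex3 C a b c al be ga x : @convex_set R (R * R)%type C ->
  C a -> C b -> C c -> 0 <= al -> 0 <= be -> 0 <= ga -> 0 < al + be + ga ->
  (al + be + ga) * x.1 = al * a.1 + be * b.1 + ga * c.1 ->
  (al + be + ga) * x.2 = al * a.2 + be * b.2 + ga * c.2 -> C x.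
Proof.
move=> /convex_setP H Ca Cb Cc al0 be0 ga0 s0 E1 E2.
have [bg0|bg0] := eqVneq (be + ga) 0.
  have be0' : be = 0 by lra.
  have ga0' : ga = 0 by lra.
  have al0' : al != 0 by apply: lt0r_neq0; lra.
  suff -> : x = a by [].
  rewrite be0' ga0' !mul0r !addr0 in E1 E2.
  by rewrite (surjective_pairing x) (surjective_pairing a) (mulfI al0' E1) (mulfI al0'
    E2).
have bg : 0 < be + ga by lra.
have K (t s : R) : 0 <= t -> t <= s -> 0 < s -> 0 <= t / s /\ t / s <= 1.
  by move=> t0 ts sp; split; [rewrite divr_ge0 ?(ltW sp)|rewrite ler_pdivrMr ?mul1r].
have [t0 t1] := K be (be + ga) be0 ltac:(lra) bg.
have [r0 r1] := K al (al + be + ga) al0 ltac:(lra) s0.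
have := H _ _ _ r0 r1 Ca (H _ _ _ t0 t1 Cb Cc) => /=; congr C.
rewrite [RHS]surjective_pairing; congr pair.
  by apply: (mulfI (lt0r_neq0 s0)); rewrite E1; field; rewrite bg0 lt0r_neq0.
by apply: (mulfI (lt0r_neq0 s0)); rewrite E2; field; rewrite bg0 lt0r_neq0.
Qed.

Lemma convex_halfplane u (c : R) : @convex_set R (R * R)%type [set x | c <= dot u x].
Proof.
apply/convex_setP => x y t t0 t1; rewrite /= /dot /= => Hx Hy.
have -> : u.1 * (t * x.1 + (1 - t) * y.1) + u.2 * (t * x.2 + (1 - t) * y.2) =
  c + (t * (u.1 * x.1 + u.2 * x.2 - c) + (1 - t) * (u.1 * y.1 + u.2 * y.2 - c)) by ring.
by rewrite lerDl addr_ge0// mulr_ge0// ?subr_ge0//.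
Qed.

Lemma convhull_sub (A C : set (R * R)) : @convex_set R (R * R)%type C -> A `<=` C ->
  convhull A `<=` C.
Proof. exact: smallest_sub. Qed.

Lemma sub_convhull (A : set (R * R)) : A `<=` convhull A.
Proof. exact: sub_gen_smallest. Qed.

Lemma convex_convhull (A : set (R * R)) : @convex_set R (R * R)%type (convhull A).
Proof.
apply/convex_setP => x y t t0 t1 Hx Hy B [cB AB].
by move/convex_setP: (cB); apply => //; [apply: Hx|apply: Hy].
Qed.

(* The points [a] are added one at a time: either all earlier points lie weakly on
   one side of the line through [x] and [a], and the separating vector is a small rotation of its normal, or [a - x]
   is a positive combination of two vectors that are already separated. *)
Lemma separation C x (s : seq (R * R)) : @convex_set R (R * R)%type C ->
  (forall a, a \in s -> C a) -> ~ C x ->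
  exists u, forall a, a \in s -> dot u x < dot u a.
Proof.
move=> cC; elim: s => [_ _|a s IH sC nCx]; first by exists 0.
have [|u uP] := IH _ nCx; first by move=> b bs; apply: sC; rewrite inE bs orbT.
have Ca : C a by apply: sC; rewrite mem_head.
have Cs b : b \in s -> C b by move=> bs; apply: sC; rewrite inE bs orbT.
have [ua|ua] := ltP (dot u x) (dot u a).
  by exists u => b; rewrite inE => /predU1P[->|/uP].
pose d (b : R * R) := (a.1 - x.1) * (b.2 - x.2) - (a.2 - x.2) * (b.1 - x.1).
pose n2 := (a.1 - x.1) ^+ 2 + (a.2 - x.2) ^+ 2.
have n20 : 0 < n2.
  rewrite lt_neqAle eq_sym addr_ge0 ?sqr_ge0// andbT paddr_eq0 ?sqr_ge0//.
  rewrite !sqrf_eq0 !subr_eq0; apply/negP => /andP[/eqP E1 /eqP E2].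
  by apply: nCx; rewrite (surjective_pairing x) -E1 -E2 -surjective_pairing.
have side (sg : R) : sg != 0 -> (forall b, b \in s -> 0 <= sg * d b) ->
    exists u, forall b, b \in a :: s -> dot u x < dot u b.
  move=> sg0 sd.
  pose f (b : R * R) := (a.1 - x.1) * (b.1 - x.1) + (a.2 - x.2) * (b.2 - x.2).
  have [|N N0 HN] := @eventually_all R _ (fun M b => 0 < M * (sg * d b) + f b) s.
    move=> b bs; have := sd b bs; rewrite le_eqVlt => /predU1P[z|gt0].
      exists 0 => // M _; rewrite -z mulr0 add0r ltNge; apply/negP => fb.
      have db : d b = 0 by apply/eqP; move/esym/eqP: z; rewrite mulf_eq0 (negbTE sg0).
      (* Here [b] lies on the line through [x] and [a], not on the side of [a], so [x] is between
         the two. *)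
      apply: nCx; apply: (@convex3 C a b b (- f b) n2 0) => //;
        rewrite ?oppr_ge0 ?(ltW n20)//.
      - exact: Cs.
      - exact: Cs.
      - by move: fb n20; lra.
      - have : (a.2 - x.2) * d b = 0 by rewrite db mulr0.
        rewrite /d /f /n2; lra.
      - have : (a.1 - x.1) * d b = 0 by rewrite db mulr0.
        rewrite /d /f /n2; lra.
    exists ((1 + `|f b|) / (sg * d b)); first by rewrite divr_ge0 ?addr_ge0// ltW.
    move=> M; rewrite ler_pdivrMr// => H; have := ler_norm (- f b); rewrite normrN; lra.
  exists (- (N * sg) * (a.2 - x.2) + (a.1 - x.1), N * sg * (a.1 - x.1) + (a.2 - x.2)).
  have E b : dot (- (N * sg) * (a.2 - x.2) + (a.1 - x.1),
    N * sg * (a.1 - x.1) + (a.2 - x.2)) b =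
    dot (- (N * sg) * (a.2 - x.2) + (a.1 - x.1), N * sg * (a.1 - x.1) + (a.2 - x.2)) x +
     (N * (sg * d b) + f b) by rewrite /dot /d /f /=; ring.
  move=> b; rewrite (E b) ltrDl inE => /predU1P[->|bs]; last exact: HN.
  have -> : f a = n2 by rewrite /f /n2; ring.
  have -> : d a = 0 by rewrite /d; ring.
  by rewrite !mulr0 add0r.
have [/allP pos|/allPn[c cs c0]] := boolP (all (fun b => 0 <= 1 * d b) s).
  exact: (side 1 (oner_neq0 _)).
have [/allP neg|/allPn[b bs b0]] := boolP (all (fun b => 0 <= -1 * d b) s).
  by apply: (side (-1)); first by rewrite oppr_eq0 oner_neq0.
rewrite -ltNge mul1r in c0; rewrite -ltNge in b0.
have db : 0 < d b by lra.
(* Up to a common factor, [e], [- d c] and [d b] are the barycentric coordinates of [x] in the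
   triangle [a, b, c]. If [e >= 0], then [x] is in the triangle; if [e < 0], solving for [a - x]
   gives the positive combination [K]. *)
pose e := (b.1 - x.1) * (c.2 - x.2) - (b.2 - x.2) * (c.1 - x.1).
have [e0|e0] := leP 0 e.
  exfalso; apply: nCx; apply: (@convex3 C a b c e (- d c) (d b)) => //;
    rewrite ?oppr_ge0 ?(ltW db)//.
  - exact: Cs.
  - exact: Cs.
  - lra.
  - lra.
  - rewrite /e /d; ring.
  - rewrite /e /d; ring.
exfalso.
have K : (dot u a - dot u x) * (- e) = (dot u b - dot u x) * (- d c) + (dot u c - dot u
  x) * d b.
  by rewrite /dot /e /d; ring.
have K1 : 0 < (dot u b - dot u x) * (- d c) by apply: mulr_gt0; [rewrite subr_gt0 uP|lra].
have K2 : 0 < (dot u c - dot u x) * d b by apply: mulr_gt0 => //; rewrite subr_gt0 uP.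
have K3 : (dot u a - dot u x) * (- e) <= 0 by apply: mulr_le0_ge0; [rewrite subr_le0|lra].
lra.
Qed.

End convex.

Section hull.
Context {R : realType}.
Implicit Types (x y u : R * R) (P : set (R * R)).

Definition perp u : R * R := (- u.2, u.1).

Lemma dot_eq0 u : u.1 ^+ 2 + u.2 ^+ 2 = 0 -> u = 0.
Proof.
move/eqP; rewrite paddr_eq0 ?sqr_ge0// !sqrf_eq0 => /andP[/eqP E1 /eqP E2].
by rewrite (surjective_pairing u) E1 E2.
Qed.

Lemma norm2_gt0 u : u != 0 -> 0 < u.1 ^+ 2 + u.2 ^+ 2.
Proof.
move=> u0; rewrite lt_neqAle eq_sym addr_ge0 ?sqr_ge0// andbT.
by apply: contraNneq u0 => /dot_eq0->.
Qed.

Lemma dot_perp_inj u x y : u != 0 -> dot u x = dot u y ->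
  dot (perp u) x = dot (perp u) y -> x = y.
Proof.
move=> /norm2_gt0/lt0r_neq0 n0; rewrite /dot /perp /= => E1 E2.
rewrite (surjective_pairing x) (surjective_pairing y); congr pair; apply: (mulfI n0).
  have -> : (u.1 ^+ 2 + u.2 ^+ 2) * x.1 = u.1 * (u.1 * x.1 + u.2 * x.2) - u.2 * (- u.2
    * x.1 + u.1 * x.2) by ring.
  by rewrite E1 E2; ring.
have -> : (u.1 ^+ 2 + u.2 ^+ 2) * x.2 = u.2 * (u.1 * x.1 + u.2 * x.2) + u.1 * (- u.2 *
  x.1 + u.1 * x.2) by ring.
by rewrite E1 E2; ring.
Qed.

(** Transfers the property that [v] is the unique minimiser of [dot u] from the generators to their
    convex hull. *)
Lemma convex_exposed u (v : R * R) : @convex_set R (R * R)%type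
  [set y | dot u v <= dot u y /\ (dot u y = dot u v -> y = v)].
Proof.
apply/convex_setP => x y t t0 t1 /= [Hx Ex] [Hy Ey].
have E : dot u (t * x.1 + (1 - t) * y.1, t * x.2 + (1 - t) * y.2) =
    dot u v + (t * (dot u x - dot u v) + (1 - t) * (dot u y - dot u v)).
  by rewrite /dot /=; ring.
have A : 0 <= t * (dot u x - dot u v) by rewrite mulr_ge0 ?subr_ge0.
have B : 0 <= (1 - t) * (dot u y - dot u v) by rewrite mulr_ge0 ?subr_ge0.
rewrite E; split=> [|H]; first by rewrite lerDl addr_ge0.
have /eqP : t * (dot u x - dot u v) = 0 by lra.
have /eqP : (1 - t) * (dot u y - dot u v) = 0 by lra.
rewrite !mulf_eq0 !subr_eq0 => /orP[/eqP t1'|/eqP/Ey yv] /orP[/eqP t0'|/eqP/Ex xv].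
- by move: t1'; rewrite t0' => /eqP; rewrite oner_eq0.
- by rewrite -t1' xv !mul1r subrr !mul0r !addr0 -surjective_pairing.
- by rewrite t0' yv !mul0r subr0 !mul1r !add0r -surjective_pairing.
- by rewrite xv yv -!mulrDl addrC subrK !mul1r -surjective_pairing.
Qed.

(** Take the generator that is lexicographically least for [dot u] and then [dot (perp u)]. For [N]
    large, [N * u + perp u] exposes it as a vertex. *)
Lemma exists_vertex (s : seq (R * R)) u : s != [::] -> u != 0 ->
  exists v, [/\ v \in s, vertex (convhull [set` s]) v &
    forall y, convhull [set` s] y -> dot u v <= dot u y].
Proof.
move=> s0 u0.
have [v0 v0s v0min] := seq_argmax (fun a => - dot u a) s0.
pose L := [seq a <- s | dot u a == dot u v0].
have L0 : L != [::].
  by apply/eqP => E; have : v0 \in L; [rewrite mem_filter eqxx v0s|rewrite E].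
have [v] := seq_argmax (fun a => - dot (perp u) a) L0.
rewrite mem_filter => /andP[/eqP vv0 vs] vmin.
have umin b : b \in s -> dot u v <= dot u b.
  by move=> /v0min; rewrite lerN2 vv0.
exists v; split=> //; last first.
  suff : convhull [set` s] `<=` [set y | dot u v <= dot u y] by [].
  by apply: convhull_sub; [exact: convex_halfplane|exact: umin].
have [|N N0 HN] := @eventually_all R _ (fun M b => b != v ->
    0 < M * (dot u b - dot u v) + (dot (perp u) b - dot (perp u) v)) s.
  move=> b bs; have := umin b bs; rewrite le_eqVlt => /predU1P[ub|ub].
    exists 0 => // M _ bv; rewrite -ub subrr mulr0 add0r subr_gt0 lt_neqAle.
    have bL : b \in L by rewrite mem_filter -ub vv0 eqxx bs.
    have := vmin _ bL; rewrite lerN2 => ->; rewrite andbT.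
    apply: contraNneq bv => E; apply/eqP; apply: (dot_perp_inj u0) => //.
  exists ((1 + `|dot (perp u) b - dot (perp u) v|) / (dot u b - dot u v)).
    by apply: divr_ge0; [rewrite addr_ge0|rewrite subr_ge0 ltW].
  move=> M; rewrite ler_pdivrMr ?subr_gt0// => H _.
  by have := ler_norm (- (dot (perp u) b - dot (perp u) v)); rewrite normrN; lra.
pose w : R * R := (N * u.1 + (perp u).1, N * u.2 + (perp u).2).
have wE y : dot w y = N * dot u y + dot (perp u) y by rewrite /w /dot /=; ring.
have sub : convhull [set` s] `<=` [set y | dot w v <= dot w y /\ (dot w y = dot w v ->
  y = v)].
  apply: convhull_sub => [|b /= bs]; first exact: convex_exposed.
  have [->|bv] := eqVneq b v; first by split.
  have := HN N (lexx _) b bs bv; rewrite !wE => H; split=> [|E]; first lra.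
  by exfalso; lra.
have Pv : convhull [set` s] v by apply: sub_convhull.
exists w; apply/seteqP; split=> [y [Py ymin]|y ->].
  have [H1 H2] := sub _ Py; apply: H2; apply/eqP; rewrite eq_le H1 andbT.
  exact: ymin.
by split=> // y' /sub[].
Qed.

(** Replaces [P] by a finite list of integer vertices. The last clause is the description of [P] by
    half-planes, which comes from [separation]. *)
Lemma polygon_vertices P : lattice_polygon P -> exists V : seq (int * int),
  [/\ (forall v, v \in V -> vertex P (lattice_vec v)),
      (forall w, vertex P w -> exists2 v, v \in V & w = lattice_vec v),
      (forall u, exists2 v, v \in V & forall y, P y -> dot u (lattice_vec v) <= dot u y) &
      (forall x, (forall u, exists2 v, v \in V & dot u (lattice_vec v) <= dot u x) ->
        P x)].
Proof.
move=> [[[s PE] [c ci]] lat].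
have s0 : s != [::].
  apply/eqP => s0; have Pc : P c by exact: interior_subset ci.
  move: Pc; rewrite PE s0 => /(_ set0); apply; split=> //.
pose V := [seq floor_vec x | x <- s & `[< vertex P x >]].
have vV v : v \in V -> vertex P (lattice_vec v).
  case/mapP => x; rewrite mem_filter => /andP[/asboolP vx xs] ->.
  by rewrite lattice_floor//; exact: lat.
have sV x : x \in s -> vertex P x -> exists2 v, v \in V & x = lattice_vec v.
  move=> xs vx; exists (floor_vec x).
    by apply/mapP; exists x => //; rewrite mem_filter xs andbT; apply/asboolP.
  by rewrite lattice_floor//; exact: lat.
have Vmin u : exists2 v, v \in V & forall y, P y -> dot u (lattice_vec v) <= dot u y.
  have [->|u0] := eqVneq u 0.
    have n0 : (1, 0) != 0 :> R * R by rewrite xpair_eqE oner_eq0.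
    have [v [vs vv _]] := exists_vertex s0 n0.
    rewrite -PE in vv; have [w wV _] := sV _ vs vv; exists w => // y _.
    by rewrite /dot /= !mul0r.
  have [v [vs vv vm]] := exists_vertex s0 u0.
  rewrite -PE in vv vm; have [w wV E] := sV _ vs vv; exists w => // y.
  by rewrite -E; exact: vm.
have vP w : vertex P w -> P w.
  move=> [u fu]; have : face P u w by rewrite fu.
  by case.
exists V; split=> //.
- move=> w vw; have [u fu] := vw; have [v vVv vm] := Vmin u; exists v => //.
  have : face P u (lattice_vec v) by split; [exact/vP/vV|exact: vm].
  by rewrite fu /=.
- move=> x H; apply: contrapT => nPx.
  have cP : @convex_set R (R * R)%type P by rewrite PE; exact: convex_convhull.
  have [|u uP] := @separation R P x (map lattice_vec V) cP _ nPx.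
    by move=> _ /mapP[v vVv ->]; exact/vP/vV.
  have [v vVv] := H u; rewrite leNgt => /negP; apply.
  by apply: uP; apply: map_f.
Qed.

Lemma interior_step P c : interior P c ->
  exists2 rho : R, 0 < rho & forall y, `|y.1 - c.1| < rho -> `|y.2 - c.2| < rho -> P y.
Proof.
move/nbhs_ballP => [e e0 H]; exists e => // y H1 H2; apply: H.
by split; rewrite /ball /= distrC.
Qed.

Lemma step_interior P c (rho : R) : 0 < rho ->
  (forall y, `|y.1 - c.1| < rho -> `|y.2 - c.2| < rho -> P y) -> interior P c.
Proof.
move=> r0 H; apply/nbhs_ballP; exists rho => // y [H1 H2].
by apply: H; rewrite distrC.
Qed.

End hull.

(** * Indecomposable lattice vectors of the normal fan *)

Lemma int_threshold (C : int -> Prop) (m0 : int) : (exists j, C j) ->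
  (forall j, C j -> m0 <= j) -> exists j, C j /\ ~ C (j - 1).
Proof.
move=> [j Cj] lb; pose P n := `[< C (m0 + n%:Z) >].
have exP : exists n, P n.
  exists `|j - m0|%N; apply/asboolP; have := lb _ Cj => H.
  by have -> : m0 + `|j - m0|%N%:Z = j by lia.
case: (ex_minnP exP) => n /asboolP Pn nmin; exists (m0 + n%:Z); split=> // C'.
have := lb _ C'; case: n Pn nmin C' => [|n] Pn nmin C'; first by lia.
have /nmin : P n by apply/asboolP; have -> : m0 + n%:Z = m0 + n.+1%:Z - 1 by lia.
by rewrite ltnn.
Qed.

Lemma pairingD (R : realDomainType) a b (x : R * R) : pairing (a + b) x = pairing a x +
  pairing b x.
Proof. rewrite /pairing /= !intrD; ring. Qed.

Lemma pairing0 (R : realDomainType) (x : R * R) : pairing 0 x = 0.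
Proof. by rewrite /pairing /= !mul0r addr0. Qed.

Lemma det0r a : det a 0 = 0.
Proof. by rewrite /det /= !mulr0 subrr. Qed.

Lemma pairing_int_comb i j a b (x : int * int) : pairing (comb i j a b) x = i * pairing
  a x + j * pairing b x.
Proof. by rewrite pairing_comb !intz. Qed.

Lemma pairingB (x : int * int) a b : pairing (a - b) x = pairing a x - pairing b x.
Proof. by rewrite !pairing_int /=; ring. Qed.

Section irreducible.
Variables (V : seq (int * int)) (H : int * int -> int) (c0 : int * int).
Hypothesis Hex : forall u, exists2 v, v \in V & pairing u v = H u.
Hypothesis Hle : forall u v, v \in V -> H u <= pairing u v.
Hypothesis Hc0 : forall u, u != 0 -> H u + 1 <= pairing u c0.

Definition ncone v u := forall w, w \in V -> pairing u v <= pairing u w.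

Lemma ncone_H v u : v \in V -> ncone v u -> pairing u v = H u.
Proof.
move=> vV Nu; apply/eqP; rewrite eq_le Hle// andbT.
by have [w wV <-] := Hex u; exact: Nu.
Qed.

Lemma H_ncone v u : pairing u v = H u -> ncone v u.
Proof. by move=> E w wV; rewrite E; exact: Hle. Qed.

Lemma nconeD v a b : ncone v a -> ncone v b -> ncone v (a + b).
Proof. by move=> Na Nb w wV; rewrite !pairingD lerD// ?Na ?Nb. Qed.

Lemma ncone_comb v i j a b : 0 <= i -> 0 <= j -> ncone v a -> ncone v b ->
  ncone v (comb i j a b).
Proof.
by move=> i0 j0 Na Nb w wV; rewrite !pairing_int_comb lerD// ler_wpM2l// ?Na ?Nb.
Qed.

Lemma nconeM v m a : 0 < m -> ncone v (comb m 0 a a) -> ncone v a.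
Proof.
move=> m0 N w wV; have := N w wV; rewrite !pairing_int_comb !mul0r !addr0.
by rewrite ler_pM2l.
Qed.

Definition indecomposable u := u != 0 /\ forall a b, a != 0 -> b != 0 -> u = a + b ->
  H a + H b < H u.

Lemma indec_ncone u v a b : indecomposable u -> v \in V -> a != 0 -> b != 0 ->
  u = a + b ->
  ncone v a -> ncone v b -> False.
Proof.
move=> [_ /(_ a b) I] vV a0 b0 E Na Nb; have := I a0 b0 E.
by rewrite E -(ncone_H vV Na) -(ncone_H vV Nb) -(ncone_H vV (nconeD Na Nb)) pairingD ltxx.
Qed.

(** [H] is superadditive, and equality forces a vertex that minimises [a + b] to minimise [a] and
    [b]. *)
Lemma ncone_split v u a b : v \in V -> ncone v u -> u = a + b -> H u <= H a + H b ->
  ncone v a /\ ncone v b.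
Proof.
move=> vV Nu E le; have := ncone_H vV Nu; rewrite {1}E pairingD => E'.
have := Hle a vV; have := Hle b vV => H1 H2.
by split; apply: H_ncone; lia.
Qed.

Lemma ncone_c0 v u : v \in V -> ncone v u -> u != 0 -> pairing u v < pairing u c0.
Proof. by move=> vV Nu u0; rewrite (ncone_H vV Nu) -lezD1; exact: Hc0. Qed.

Lemma pair_neq0 (u : int * int) : u != 0 -> u.1 != 0 \/ u.2 != 0.
Proof.
have [E|] := eqVneq u.1 0; last by left.
by have [E'|] := eqVneq u.2 0; [rewrite (surjective_pairing u) E E' eqxx|right].
Qed.

(** If [u = g q] with [g > 1], then [u = q + (g - 1) q] is a decomposition inside one normal cone.
    Hence [u] is primitive, and Bezout gives [x]. *)
Lemma indec_unimodular u : indecomposable u -> exists x, det u x = 1.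
Proof.
move=> Iu; have [u0 _] := Iu.
suff g1 : gcdz u.1 u.2 = 1.
  have [m [n E]] := Bezoutz u.1 u.2; exists (- n, m); move: E; rewrite g1 => <-.
  rewrite /det /=; ring.
have [q1 E1] := dvdzP (dvdz_gcdl u.1 u.2); have [q2 E2] := dvdzP (dvdz_gcdr u.1 u.2).
set g := gcdz _ _ in E1 E2 *.
have g0 : 0 < g.
  rewrite lt_neqAle eq_sym gcdz_eq0 negb_and; apply/andP; split=> //.
  by apply/orP; exact: pair_neq0.
apply/eqP; rewrite eq_le andbC -gtz0_ge1 g0 /= leNgt; apply/negP => g1.
have [v vV vE] := Hex u; have Nu := H_ncone vE.
have uE : u = comb g 0 (q1, q2) (q1, q2).
  by rewrite (surjective_pairing u) /comb /= E1 E2; congr pair; ring.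
have Nq : ncone v (q1, q2) by apply: (@nconeM v g) => //; rewrite -uE.
have q0 : (q1, q2) != 0.
  by apply: contraNneq u0 => q0; rewrite uE q0 /comb /= mulr0.
apply: (@indec_ncone u v (q1, q2) (comb (g - 1) 0 (q1, q2) (q1, q2))) => //.
- apply: contraNneq q0 => -[/eqP + /eqP].
  rewrite !mul0r !addr0 !mulf_eq0 => /orP[/eqP|/eqP->]; first by lia.
  by move=> /orP[/eqP|/eqP->]//; lia.
- by rewrite uE /comb; congr pair => /=; ring.
- by apply: ncone_comb => //; lia.
Qed.

(** The vectors of determinant 1 with [u] are the [x0 + j u]. For large [j] such a vector is
    minimised at the vertex that minimises [u] and then [x0]; [b] is the one with the least [j] that
    shares a normal cone with [u]. *)
Lemma indec_succ u : indecomposable u -> exists b v, [/\ det u b = 1, v \in V,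
  ncone v u, ncone v b &
  forall v, v \in V -> ncone v u -> ~ ncone v (b - u)].
Proof.
move=> Iu; have [u0 _] := Iu; have [x0 D] := indec_unimodular Iu.
pose X j := comb 1 j x0 u.
pose C j := exists2 v, v \in V & ncone v u /\ ncone v (X j).
have DX j : det u (X j) = 1 by rewrite -D /det /X /=; ring.
have X0 j : X j != 0 by apply/eqP => E; have := DX j; rewrite E det0r.
have exC : exists j, C j.
  pose L := [seq v <- V | pairing u v == H u].
  have L0 : L != [::].
    have [v vV vE] := Hex u; apply/eqP => E.
    by have : v \in L; [rewrite mem_filter vE eqxx vV|rewrite E].
  have [v + vmin] := seq_argmax (fun v : int * int => - pairing x0 v) L0.
  rewrite mem_filter => /andP[/eqP vE vV].
  have [|N N0 HN] := @eventually_all int _ (fun M w =>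
    pairing (X M) v <= pairing (X M) w) V.
    move=> w wV; have := Hle u wV; rewrite le_eqVlt => /predU1P[E|lt].
      exists 0 => // M _; rewrite !pairing_int_comb -E vE lerD2r !mul1r.
      by rewrite -lerN2; apply: vmin; rewrite mem_filter -E eqxx.
    exists `|pairing x0 v - pairing x0 w| => // M le.
    rewrite !pairing_int_comb vE; move: lt le; clear.
    move: (pairing x0 v) (pairing x0 w) (pairing u w) (H u) => a b c d lt le.
    have : M * 1 <= M * (c - d) by apply: ler_wpM2l; lia.
    by rewrite mulrBr; lia.
  by exists N; exists v => //; split; [exact: H_ncone|exact: HN].
(* On the normal cone of [v] the functional [c0 - v] is at least 1 on nonzero lattice vectors, which
   fails at [x0 + j u] for very negative [j]. *)
have lbC : exists m0, forall j, C j -> m0 <= j.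
  have V0 : V != [::] by have [v vV _] := Hex 0; apply/eqP => E; rewrite E in vV.
  have [v1 _ vmax] := seq_argmax (fun v : int * int => - pairing x0 v) V0.
  exists (- `|pairing x0 c0 - pairing x0 v1|) => j [v vV [Nu Nx]].
  have := ncone_c0 vV Nx (X0 j); have := ncone_c0 vV Nu u0; have := vmax v vV.
  rewrite !pairing_int_comb lerN2; move: (pairing x0 v) (pairing x0 v1) (pairing x0 c0)
    (pairing u v) (pairing u c0).
  move=> a a1 a0 b b0 h1 h2 h3.
  have [j0|j0] := leP 0 j; first by lia.
  have : j * (b0 - b) <= j * 1 by apply: ler_wnM2l; lia.
  by rewrite mulrBr; lia.
have [m0 /(int_threshold exC)[j [[v vV [Nu Nx]] nC]]] := lbC.
exists (X j), v; split=> // v' v'V Nu' Nb; apply: nC; exists v' => //; split=> //.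
suff <- : X j - u = X (j - 1) by [].
by rewrite /X /comb; congr pair => /=; ring.
Qed.

(** In a decomposition [b = c + d] inside the cone of [v], the integers [det u c] and [det u d] add
    up to 1, so one of them is at most 0; [key] excludes that. *)
Lemma indec_succ_indec u b v : indecomposable u -> det u b = 1 -> v \in V ->
  ncone v u -> ncone v b ->
  ~ ncone v (b - u) -> indecomposable b.
Proof.
move=> Iu D vV Nu Nb nb; have [u0 _] := Iu.
have b0 : b != 0 by apply/eqP => E; move: D; rewrite E det0r.
have key c d : d != 0 -> ncone v c -> ncone v d -> b = c + d -> det u d <= 0 -> False.
  move=> d0 Nc Nd E f0.
  have dE : d = comb (det d b) (det u d) u b by exact: det_coord.
  move: (det d b) (det u d) dE f0 => m f dE f0.
  have m0 : 0 < m.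
    have := ncone_c0 vV Nd d0; have := ncone_c0 vV Nu u0; have := ncone_c0 vV Nb b0.
    rewrite dE !pairing_int_comb; move: (pairing u v) (pairing u c0) (pairing b v)
      (pairing b c0) => x x' y y'.
    rewrite -subr_gt0 -(subr_gt0 x) -(subr_gt0 (m * x + _)) => h1 h2 h3.
    rewrite -(pmulr_lgt0 _ h2).
    have : f * (y' - y) <= 0 by rewrite mulr_le0_ge0 ?(ltW h1).
    move: h3; rewrite !mulrBr; lia.
  have cE w : pairing c w = pairing b w - (m * pairing u w + f * pairing b w).
    by rewrite -pairing_int_comb -dE -pairingB E addrK.
  have dE' w : pairing d w = m * pairing u w + f * pairing b w by rewrite dE
    pairing_int_comb.
  (* Here [d = m u + f b] with [m > 0 >= f]. If [m >= 1 - f], then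
     [(1 - f)(b - u) = c + (m - (1 - f)) u] puts [b - u] in the cone, against the choice of [b]. *)
  have [mf|mf] := leP (1 - f) m.
    apply: nb => w wV; have := Nc w wV; have := Nu w wV; rewrite !cE !pairingB.
    move: (pairing u v) (pairing u w) (pairing b v) (pairing b w) => y y' x x' h1 h2.
    have : (1 - f) * (y' - y) <= m * (y' - y) by rewrite ler_wpM2r ?subr_ge0.
    have : (1 - f) * ((x' - x) - (y' - y)) = (1 - f) * (x' - x) - (1 - f) * (y' - y) by
      ring.
    have f1 : 0 < 1 - f by lia.
    move=> h3 h4; suff : 0 <= (1 - f) * ((x' - x) - (y' - y)) by rewrite pmulr_rge0//;
      lia.
    rewrite h3; move: h4 h2; rewrite !mulrBr !mulrBl; lia.
  (* Otherwise [m <= - f], and [m (u - b) = d + (- f - m) b] puts [u - b] in the cone, so that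
     [u = (u - b) + b] decomposes. *)
  apply: (indec_ncone Iu vV (a := u - b) (b := b)) => //.
  - by rewrite subr_eq0; apply/eqP => ub; move: D; rewrite ub detxx.
  - by rewrite subrK.
  - move=> w wV; have := Nd w wV; have := Nb w wV; rewrite !dE' !pairingB.
    move: (pairing u v) (pairing u w) (pairing b v) (pairing b w) => y y' x x' h1 h2.
    have : m * (x' - x) <= - f * (x' - x) by rewrite ler_wpM2r ?subr_ge0; lia.
    have h3 : m * ((y' - y) - (x' - x)) = m * (y' - y) - m * (x' - x) by ring.
    move=> h4; suff : 0 <= m * ((y' - y) - (x' - x)) by rewrite pmulr_rge0//; lia.
    rewrite h3; move: h4 h2; rewrite !mulrBr !mulNr; lia.
split=> // c d c0' d0' E; rewrite ltNge; apply/negP => le.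
have [Nc Nd] := ncone_split vV Nb E le.
have : det u c + det u d = 1 by rewrite -D E /det /=; ring.
have [f0 _|f0 S] := leP (det u d) 0; first exact: (key c d).
by apply: (key d c) => //; [rewrite addrC|lia].
Qed.

(** A lattice vector in the open cone has positive integer coordinates in [u, b], so a copy of [u]
    splits off inside the cone. *)
Lemma ncone_irr_open u b v x : v \in V -> ncone v u -> ncone v b -> det u b = 1 ->
  indecomposable x -> 0 < det u x -> 0 < det x b -> False.
Proof.
move=> vV Nu Nb D Ix ux xb.
have b0 : b != 0 by apply/eqP => E; move: D; rewrite E det0r.
have u0 : u != 0 by apply/eqP => E; move: D; rewrite E /det /= !mul0r subrr.
have xE := det_coord x D.
apply: (indec_ncone Ix vV (a := u) (b := comb (det x b - 1) (det u x) u b)) => //.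
- apply/eqP => E; have : det u (comb (det x b - 1) (det u x) u b) = 0 by rewrite E det0r.
  by rewrite detE D; lia.
- by rewrite {1}xE /comb; congr pair => /=; ring.
- by apply: ncone_comb => //; lia.
Qed.

(* Minimize [pairing x c0 - H x >= 1] over the nonzero [x]. *)
Lemma indec_exists : exists u, indecomposable u.
Proof.
pose K u := `|pairing u c0 - H u|%N.
have KE u : u != 0 -> (K u)%:Z = pairing u c0 - H u.
  by move=> u0; rewrite /K; have := Hc0 u0; lia.
pose Pn n := `[< exists2 u, u != 0 & K u = n >].
have exP : exists n, Pn n.
  by exists (K (1, 0)); apply/asboolP; exists (1, 0).
case: (ex_minnP exP) => n /asboolP[u u0 Kn] nmin.
exists u; split=> // a b a0 b0 E; rewrite ltNge; apply/negP => le.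
have /nmin : Pn (K a) by apply/asboolP; exists a.
have zE : pairing u c0 = pairing a c0 + pairing b c0 by rewrite E pairingD.
have := KE u u0; have := KE a a0; have := Hc0 b0; rewrite Kn zE.
by move: le; lia.
Qed.

Lemma indec_diff a b : indecomposable a -> b != 0 -> a != b -> H (a - b) + H b + 1 <= H a.
Proof.
by move=> [_ I] b0 ab; rewrite lezD1; apply: I; rewrite ?subrK// subr_eq0.
Qed.

(* Evaluate [H (i a - m b)] at a vertex [v] minimizing [a - b]. *)
Lemma indec_diff_bound a b i m : indecomposable a -> b != 0 -> a != b ->
  1 <= i -> i <= m -> H (comb i (- m) a b) + 1 <= i * (H a + 1) - m * (H b + 1).
Proof.
move=> Ia b0 ab i1 im; have [v vV vE] := Hex (a - b).
have := indec_diff Ia b0 ab; rewrite -vE pairingB => h1.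
have := Hle (comb i (- m) a b) vV; rewrite pairing_int_comb => h2; have h3 := Hle a vV.
have h4 : m * (pairing a v - pairing b v + H b + 1) <= m * H a by apply: ler_wpM2l =>
  //; lia.
have h5 : (m - i) * H a <= (m - i) * pairing a v by apply: ler_wpM2l => //; lia.
move: h2 h4 h5 i1; lra.
Qed.

(* If [w] lies in the cone opposite to that of [a] and [b], the bound comes from the
   interior lattice point [c0]; otherwise from indecomposability of [a] or [b]. *)
Lemma adjoint_nef a b v w : indecomposable a -> indecomposable b -> det a b = 1 ->
  v \in V ->
  ncone v a -> ncone v b -> w != 0 ->
  H w + 1 <= det w b * (H a + 1) + det a w * (H b + 1).
Proof.
move=> Ia Ib D vV Na Nb w0; have [a0 _] := Ia; have [b0 _] := Ib.
have ab : a != b by apply/eqP => ab; move: D; rewrite ab detxx.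
have wE : w = comb (det w b) (det a w) a b by exact: det_coord.
move: (det w b) (det a w) wE => i j wE.
(* In this case nefness of [H] suffices: the right-hand side gains [i + j >= 1]. *)
have [ij|ij] := leP 1 (i + j).
  have := Hle w vV; rewrite wE pairing_int_comb (ncone_H vV Na) (ncone_H vV Nb).
  by rewrite !mulrDr !mulr1; lia.
have [i0|i0] := leP 1 i.
  rewrite wE -[j]opprK; have := @indec_diff_bound a b i (- j) Ia b0 ab i0 ltac:(lia).
  by rewrite !mulNr !opprK.
have [j0|j0] := leP 1 j.
  have -> : w = comb j i b a by rewrite wE /comb addrC; congr pair; rewrite addrC.
  rewrite -[i]opprK; have := @indec_diff_bound b a j (- i) Ib a0 _ j0 ltac:(lia).
  by rewrite eq_sym => /(_ ab); rewrite !mulNr !opprK addrC [X in _ -> _ <= X]addrC addrC.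
have := Hc0 w0; rewrite {2}wE pairing_int_comb => h.
have : i * pairing a c0 <= i * (H a + 1) by apply: ler_wnM2l; [lia|exact: Hc0].
have : j * pairing b c0 <= j * (H b + 1) by apply: ler_wnM2l; [lia|exact: Hc0].
lia.
Qed.

End irreducible.

Lemma bounded_list (Q : int * int -> Prop) (B : int) :
  (forall u, Q u -> `|u.1| <= B /\ `|u.2| <= B) ->
  exists U : seq (int * int), uniq U /\ forall u, u \in U <-> Q u.
Proof.
move=> HB; pose L : seq int := [seq i%:Z - B | i <- iota 0 (absz (2 * B + 1))].
have memL z : `|z| <= B -> z \in L.
  move=> zB; apply/mapP; exists (absz (z + B)); last by lia.
  by rewrite mem_iota /=; lia.
exists (undup [seq u <- [seq (x, y) | x <- L, y <- L] | `[< Q u >]]).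
split=> [|u]; first exact: undup_uniq.
rewrite mem_undup mem_filter; split=> [/andP[/asboolP]//|Qu].
have [B1 B2] := HB u Qu; apply/andP; split; first exact/asboolP.
by apply/allpairsP; exists u; split; [exact: memL|exact: memL|exact: surjective_pairing].
Qed.

Section indec_fan.
Variables (V : seq (int * int)) (H : int * int -> int) (c0 : int * int).
Hypothesis Hex : forall u, exists2 v, v \in V & pairing u v = H u.
Hypothesis Hle : forall u v, v \in V -> H u <= pairing u v.
Hypothesis Hc0 : forall u, u != 0 -> H u + 1 <= pairing u c0.
Variable U : seq (int * int).
Hypotheses (Uu : uniq U) (UE : forall u, u \in U <-> indecomposable H u).

Lemma indec_fan_succ u : u \in U -> exists b v, [/\ b \in U, adj U u b, v \in V,
  ncone V v u & ncone V v b].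
Proof.
move=> /UE Iu; have [b [v [D vV Nu Nb nb]]] := indec_succ Hex Hle Hc0 Iu.
have Ib := indec_succ_indec Hex Hle Hc0 Iu D vV Nu Nb (nb v vV Nu).
exists b, v; split=> //; first exact/UE.
apply/adjP; split=> // x /UE Ix ux xb.
exact: (ncone_irr_open Hex Hle vV Nu Nb D Ix ux xb).
Qed.

Lemma indec_fan : fan U.
Proof.
split=> // a /indec_fan_succ[b [v [bU ab _ _ _]]]; by exists b.
Qed.

Lemma indec_fan_neq0 : U != [::].
Proof.
have [u /UE uU] := indec_exists Hc0.
by apply/eqP => E; rewrite E in uU.
Qed.

Lemma indec_fan_cone a b : a \in U -> b \in U -> adj U a b ->
  exists v, [/\ v \in V, ncone V v a & ncone V v b].
Proof.
move=> aU bU ab; have [c [v [cU ac vV Na Nc]]] := indec_fan_succ aU.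
by exists v; rewrite (adj_succI bU cU ab ac).
Qed.

Lemma indec_globally_nef : globally_nef U H.
Proof.
move=> a b aU bU ab w wU; have [v [vV Na Nb]] := indec_fan_cone aU bU ab.
rewrite -(ncone_H Hex Hle vV Na) -(ncone_H Hex Hle vV Nb).
have := pairing_coord w v (adj_det ab); rewrite !intz => <-.
exact: Hle.
Qed.

Lemma indec_nef a b w : a \in U -> b \in U -> adj U a b -> w != 0 ->
  H w + 1 <= det w b * (H a + 1) + det a w * (H b + 1).
Proof.
move=> aU bU ab w0; have [v [vV Na Nb]] := indec_fan_cone aU bU ab.
apply: (adjoint_nef Hex Hle Hc0 _ _ (adj_det ab) vV Na Nb w0); exact/UE.
Qed.

Lemma indec_adjoint_globally_nef : globally_nef U (adjoint_support H).
Proof.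
move=> a b aU bU ab w wU; apply: indec_nef => //.
by have /UE[] := wU.
Qed.

End indec_fan.

(** * Completeness of the fan over the reals *)

Section cover.
Context {R : realType}.
Variable U : seq (int * int).
Hypotheses (fU : fan U) (U0 : U != [::]).

(** A cone contains [u] as soon as [d a >= 0 >= d b] for neighbours [a, b], where [d] is the
    determinant with [u]. If there is none, [d] keeps one sign along successors, while [f], the
    cotangent of the angle from a ray to [u], strictly increases; this is impossible in a finite
    list. *)
Lemma fan_cover (u : R * R) : exists a b al be, [/\ a \in U, b \in U, adj U a b &
  [/\ 0 <= al, 0 <= be & forall x, dot u x = al * pairing a x + be * pairing b x]].
Proof.
have [_ Us] := fU.
have [->|u0] := eqVneq u 0.
  have [a aU] : exists a, a \in U by case: (U) U0 => // x l _; exists x; rewrite mem_head.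
  have [b bU ab] := Us _ aU; exists a, b, 0, 0; split=> //; split=> // x.
  by rewrite /dot /= !mul0r addr0.
pose d (a : int * int) : R := a.1%:~R * u.2 - a.2%:~R * u.1.
have [[a [b [aU bU ab da db]]]|no] := pselect (exists a b, [/\ a \in U, b \in U,
  adj U a b, 0 <= d a & d b <= 0]).
  exists a, b, (- d b), (d a); split=> //; split; rewrite ?oppr_ge0// => x.
  have D : a.1%:~R * b.2%:~R - a.2%:~R * b.1%:~R = 1 :> R.
    by rewrite -!intrM -intrB; move: (adj_det ab); rewrite /det => ->.
  rewrite -[LHS]mul1r -D /d /pairing /dot; ring.
exfalso.
have step a b : a \in U -> b \in U -> adj U a b -> 0 <= d a -> 0 < d b.
  by move=> aU bU ab da; rewrite ltNge; apply/negP => db; apply: no; exists a, b.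
pose f (a : int * int) : R := (a.1%:~R * u.1 + a.2%:~R * u.2) / d a.
have incr a b : adj U a b -> 0 < d a * d b -> f a < f b.
  move=> ab dab; have D : a.1%:~R * b.2%:~R - a.2%:~R * b.1%:~R = 1 :> R.
    by rewrite -!intrM -intrB; move: (adj_det ab); rewrite /det => ->.
  have nz : d a * d b != 0 by apply: lt0r_neq0.
  move: (nz); rewrite mulf_eq0 negb_or => /andP[nza nzb].
  rewrite -subr_gt0.
  have -> : f b - f a = (u.1 ^+ 2 + u.2 ^+ 2) / (d a * d b).
    rewrite -[X in _ = X / _]mul1r -D /f /d; field.
    by rewrite nzb nza.
  by rewrite divr_gt0// norm2_gt0.
have contra (P : int * int -> bool) : (forall a b, P a -> P b -> 0 < d a * d b) ->
    (forall a b, a \in U -> b \in U -> adj U a b -> P a -> P b) ->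
    forall a, a \in U -> P a -> False.
  move=> Pd Pst a aU Pa.
  have L0 : [seq x <- U | P x] != [::].
    by apply/eqP => E; have : a \in [seq x <- U | P x]; [rewrite mem_filter Pa|rewrite E].
  have [m + mmax] := seq_argmax f L0; rewrite mem_filter => /andP[Pm mU].
  have [b bU mb] := Us _ mU; have Pb := Pst _ _ mU bU mb Pm.
  have := mmax b; rewrite mem_filter Pb bU => /(_ isT).
  by rewrite leNgt incr// Pd.
have [[a aU da]|neg] := pselect (exists2 a, a \in U & 0 <= d a).
  have [b bU ab] := Us _ aU; have db := step _ _ aU bU ab da.
  apply: (contra (fun x => 0 < d x) _ _ b bU db) => [x y|x y xU yU xy dx].
    exact: mulr_gt0.
  exact: (step x y xU yU xy (ltW dx)).
have dneg x : x \in U -> d x < 0.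
  by move=> xU; rewrite ltNge; apply/negP => dx; apply: neg; exists x.
have [a aU] : exists a, a \in U by case: (U) U0 => // x l _; exists x; rewrite mem_head.
apply: (contra (fun x => d x < 0) _ _ a aU (dneg a aU)) => [x y dx dy|x y xU yU xy dx].
  by rewrite nmulr_rgt0.
exact: dneg.
Qed.

(** A functional separating [x] from the points of [s] would lie in some cone [a, b] of the fan, but
    there the point at which both inequalities are tight minimises it over the polygon. *)
Lemma support_polygon_sub (C : set (R * R)) h (s : seq (int * int)) :
  @convex_set R (R * R)%type C -> (forall v, v \in s -> C (lattice_vec v)) ->
  (forall a b, a \in U -> b \in U -> adj U a b ->
    exists2 v, v \in s & pairing a v = h a /\ pairing b v = h b) ->
  support_polygon U h `<=` C.
Proof.
move=> cC sC sP x Qx; apply: contrapT => nCx.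
have [|u uP] := @separation R C x (map lattice_vec s) cC _ nCx.
  by move=> _ /mapP[v vs ->]; exact: sC.
have [a [b [al [be [aU bU ab [al0 be0 E]]]]]] := fan_cover u.
have [v vs [Ea Eb]] := sP a b aU bU ab.
have := uP _ (map_f _ vs); rewrite !E ltNge => /negP; apply.
have zr w : pairing w (lattice_vec v) = (pairing w v)%:~R :> R by rewrite pairing_int
  intrD !intrM.
by rewrite !zr Ea Eb lerD// ler_wpM2l// Qx.
Qed.

End cover.

(** * Lattice polygons *)

Definition irot (w v : int * int) : int * int := (v.2 - w.2, w.1 - v.1).

Definition edge_normals (V : seq (int * int)) := [seq irot w v | w <- V, v <- V].

Section polygon.
Context {R : realType}.
Variables (P : set (R * R)) (V : seq (int * int)) (H : int * int -> int).
Hypothesis Hmin : forall u : R * R,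
  exists2 v, v \in V & forall y, P y -> dot u (lattice_vec v) <= dot u y.
Hypothesis HvP : forall v, v \in V -> P (lattice_vec v).
Hypothesis HP : forall x : R * R,
  (forall u, exists2 v, v \in V & dot u (lattice_vec v) <= dot u x) -> P x.
Hypothesis Hex : forall u, exists2 v, v \in V & pairing u v = H u.
Hypothesis Hle : forall u v, v \in V -> H u <= pairing u v.

Lemma lattice_vec_inj : injective (@lattice_vec R).
Proof.
move=> [a b] [c d] [] /eqP + /eqP; rewrite !eqr_int => /eqP-> /eqP->.
by [].
Qed.

Lemma pairing_lattice_vec w v : pairing w (lattice_vec v) = (pairing w v)%:~R :> R.
Proof. by rewrite pairing_int intrD !intrM. Qed.

Lemma interior_strict c (a : R * R) : interior P c -> a != 0 ->
  exists2 v, v \in V & dot a (lattice_vec v) < dot a c.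
Proof.
move=> /interior_step[rho r0 Hr] a0; have n0 := norm2_gt0 a0.
have s0 : 0 < 1 + `|a.1| + `|a.2| by rewrite ltr_pwDl// ltr_pwDl.
pose t := rho / (1 + `|a.1| + `|a.2|).
have t0 : 0 < t by rewrite divr_gt0.
have tE : t * (1 + `|a.1| + `|a.2|) = rho by rewrite divfK// lt0r_neq0.
have ta1 : 0 <= t * `|a.1| by rewrite mulr_ge0// ltW.
have ta2 : 0 <= t * `|a.2| by rewrite mulr_ge0// ltW.
have Py : P (c.1 - t * a.1, c.2 - t * a.2).
  by apply: Hr; rewrite /= addrAC subrr add0r normrN normrM (gtr0_norm t0); lra.
have [v vV vm] := Hmin a; exists v => //; apply: le_lt_trans (vm _ Py) _.
rewrite /dot /= -subr_gt0.
have -> : a.1 * c.1 + a.2 * c.2 - (a.1 * (c.1 - t * a.1) + a.2 * (c.2 - t * a.2)) =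
  t * (a.1 ^+ 2 + a.2 ^+ 2) by ring.
exact: mulr_gt0.
Qed.

Definition rcone v (u : R * R) := forall w, w \in V ->
  dot u (lattice_vec v) <= dot u (lattice_vec w).

Lemma rcone_lattice_vec v u : rcone v (lattice_vec u) <-> ncone V v u.
Proof.
by split=> N w wV; have := N w wV; rewrite -!pairing_dot !pairing_lattice_vec ler_int.
Qed.

Lemma rconeP u : exists2 v, v \in V & rcone v u.
Proof.
have [v vV vm] := Hmin u; exists v => // w wV; exact/vm/HvP.
Qed.

Definition scale_lattice_vec (c : R) (r : int * int) : R * R := (c * r.1%:~R,
  c * r.2%:~R).

Lemma dot_scale_lattice_vec c r x : dot (scale_lattice_vec c r) x = c * dot
  (lattice_vec r) x.
Proof. rewrite /dot /=; ring. Qed.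

Definition facet_normal v r := [/\ r \in edge_normals V, r != 0, ncone V v r &
  exists w, [/\ w \in V, w != v & pairing r w = pairing r v]].

(** [a] is orthogonal to [w - v], hence a multiple [la] of its quarter turn; the sign of [la]
    selects [irot w v] or [irot v w]. *)
Lemma facet_normalP v w (a : R * R) : v \in V -> w \in V -> w != v -> a != 0 ->
  rcone v a ->
  dot a (lattice_vec w) = dot a (lattice_vec v) ->
    exists2 r, facet_normal v r & exists2 c, 0 < c & a = scale_lattice_vec c r.
Proof.
move=> vV wV wv a0 Na E.
pose y1 : R := w.1%:~R - v.1%:~R; pose y2 : R := w.2%:~R - v.2%:~R.
have y0 : y1 ^+ 2 + y2 ^+ 2 != 0.
  apply: contraNneq wv => /(@dot_eq0 _ (y1, y2))[/eqP + /eqP].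
  rewrite !subr_eq0 !eqr_int => /eqP E1 /eqP E2.
  by rewrite (surjective_pairing w) E1 E2 -surjective_pairing.
pose la := (- (a.1 * y2) + a.2 * y1) / (y1 ^+ 2 + y2 ^+ 2).
have ay : a.1 * y1 + a.2 * y2 = 0 by move: E; rewrite /dot /= /y1 /y2; lra.
have laE : la * (y1 ^+ 2 + y2 ^+ 2) = - (a.1 * y2) + a.2 * y1 by rewrite divfK.
have a1 : a.1 = - la * y2.
  apply: (mulIf y0); transitivity (- (la * (y1 ^+ 2 + y2 ^+ 2)) * y2); last by ring.
  have : y1 * (a.1 * y1 + a.2 * y2) = 0 by rewrite ay mulr0.
  by rewrite laE; lra.
have a2 : a.2 = la * y1.
  apply: (mulIf y0); transitivity (la * (y1 ^+ 2 + y2 ^+ 2) * y1); last by ring.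
  have : y2 * (a.1 * y1 + a.2 * y2) = 0 by rewrite ay mulr0.
  by rewrite laE; lra.
have main r c : 0 < c -> a = scale_lattice_vec c r -> r \in edge_normals V ->
    exists2 r, facet_normal v r & exists2 c, 0 < c & a = scale_lattice_vec c r.
  move=> c0 aE rR; exists r; last by exists c.
  split=> //.
  - by apply: contraNneq a0 => r0; rewrite aE r0 /scale_lattice_vec /= !mulr0.
  - apply/rcone_lattice_vec => z zV; have := Na z zV; rewrite aE !dot_scale_lattice_vec.
    by rewrite ler_pM2l.
  - exists w; split=> //; move: E; rewrite aE !dot_scale_lattice_vec =>
    /(mulfI (lt0r_neq0 c0)).
    by rewrite -!pairing_dot !pairing_lattice_vec => /eqP; rewrite eqr_int => /eqP.
have [la0|la0|la0] := ltrgt0P la.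
- apply: (main (irot w v) la) => //; last by apply/allpairsP; exists (w, v).
  rewrite (surjective_pairing a) a1 a2 /scale_lattice_vec /irot /= !intrB; congr pair;
    rewrite /y1 /y2; ring.
- apply: (main (irot v w) (- la)); rewrite ?oppr_gt0//; last by apply/allpairsP;
  exists (v, w).
  rewrite (surjective_pairing a) a1 a2 /scale_lattice_vec /irot /= !intrB; congr pair;
    rewrite /y1 /y2; ring.
- by move: a0; rewrite (surjective_pairing a) a1 a2 la0 oppr0 !mul0r eqxx.
Qed.

Hypothesis Pint : interior P !=set0.

Lemma not_flat v (a : R * R) : v \in V -> a != 0 -> ~ (forall w, w \in V ->
  dot a (lattice_vec w) = dot a (lattice_vec v)).
Proof.
move=> vV a0 flat; have [c ci] := Pint.
have [w1 w1V lt1] := interior_strict ci a0.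
have na0 : - a != 0 by rewrite oppr_eq0.
have [w2 w2V lt2] := interior_strict ci na0.
have dotN x : dot (- a) x = - dot a x by rewrite /dot /=; ring.
move: lt1 lt2; rewrite !dotN (flat w1)// (flat w2)//; lra.
Qed.

(* The extreme rays of the normal cone are found by turning [u] about the vertex
   [v] until another vertex is hit; [tau w] is the slope of [w - v] relative
   to [u]. *)
Lemma normal_cone_decomp v (u : R * R) : v \in V -> u != 0 -> rcone v u ->
  exists r1 r2 c1 c2, [/\ facet_normal v r1, facet_normal v r2, 0 <= c1, 0 <= c2 &
    u = scale_lattice_vec c1 r1 + scale_lattice_vec c2 r2].
Proof.
move=> vV u0 Nu.
have [[w [wV wv E]]|no] := pselect (exists w, [/\ w \in V,
  w != v & dot u (lattice_vec w) = dot u (lattice_vec v)]).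
  have [r Fr [c cp uE]] := facet_normalP vV wV wv u0 Nu E.
  exists r, r, c, 0; split=> //; first exact: ltW.
  by rewrite uE /scale_lattice_vec !mul0r addr0.
have pos w : w \in V -> w != v -> 0 < dot u (lattice_vec w) - dot u (lattice_vec v).
  move=> wV wv; rewrite subr_gt0 lt_neqAle Nu// andbT.
  by apply/eqP => E; apply: no; exists w.
pose tau (w : int * int) := (dot (perp u) (lattice_vec w) - dot (perp u) (lattice_vec
  v)) / (dot u (lattice_vec w) - dot u (lattice_vec v)).
have tauE w : w \in V -> w != v ->
    dot (perp u) (lattice_vec w) - dot (perp u) (lattice_vec v) = tau w * (dot u
      (lattice_vec w) - dot u (lattice_vec v)).
  by move=> wV wv; rewrite divfK// lt0r_neq0// pos.
pose L := [seq w <- V | w != v].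
have L0 : L != [::].
  apply/eqP => L0; apply: (not_flat vV u0) => w wV.
  have [->//|wv] := eqVneq w v.
  by have : w \in L; [rewrite mem_filter wv|rewrite L0].
have [wp + pmax] := seq_argmax tau L0; rewrite mem_filter => /andP[wpv wpV].
have [wm + mmax] := seq_argmax (fun w => - tau w) L0;
  rewrite mem_filter => /andP[wmv wmV].
have n0 := norm2_gt0 u0.
(* These are the two extreme normals: [a1] is constant on the line through [v] and [wp], [a2] on
   that through [v] and [wm], and [a1 + a2 = (tau wp - tau wm) u]. *)
pose a1 : R * R := (tau wp * u.1 - (perp u).1, tau wp * u.2 - (perp u).2).
pose a2 : R * R := ((perp u).1 - tau wm * u.1, (perp u).2 - tau wm * u.2).
have d1 x : dot a1 x = tau wp * dot u x - dot (perp u) x by rewrite /dot /a1 /=; ring.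
have d2 x : dot a2 x = dot (perp u) x - tau wm * dot u x by rewrite /dot /a2 /=; ring.
have ru : dot (perp u) (perp u) != 0.
  have -> : dot (perp u) (perp u) = u.1 ^+ 2 + u.2 ^+ 2 by rewrite /dot /perp /=; ring.
  exact: lt0r_neq0.
have uru : dot u (perp u) = 0 by rewrite /dot /perp /=; ring.
have dot0 x : dot (0 : R * R) x = 0 by rewrite /dot /= !mul0r addr0.
have a10 : a1 != 0.
  by apply: contraNneq ru => E; have := d1 (perp u); rewrite E dot0 uru; lra.
have a20 : a2 != 0.
  by apply: contraNneq ru => E; have := d2 (perp u); rewrite E dot0 uru; lra.
have e1 w : w \in V -> w != v -> dot a1 (lattice_vec w) - dot a1 (lattice_vec v) =
    (tau wp - tau w) * (dot u (lattice_vec w) - dot u (lattice_vec v)).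
  by move=> wV wv; have := tauE w wV wv; rewrite !d1; lra.
have e2 w : w \in V -> w != v -> dot a2 (lattice_vec w) - dot a2 (lattice_vec v) =
    (tau w - tau wm) * (dot u (lattice_vec w) - dot u (lattice_vec v)).
  by move=> wV wv; have := tauE w wV wv; rewrite !d2; lra.
have N1 : rcone v a1.
  move=> w wV; have [->//|wv] := eqVneq w v; rewrite -subr_ge0 e1//.
  rewrite mulr_ge0 ?(ltW (pos _ _ _))// subr_ge0; apply: pmax.
  by rewrite mem_filter wv.
have N2 : rcone v a2.
  move=> w wV; have [->//|wv] := eqVneq w v; rewrite -subr_ge0 e2//.
  rewrite mulr_ge0 ?(ltW (pos _ _ _))// subr_ge0 -lerN2; apply: mmax.
  by rewrite mem_filter wv.
(* Equal slopes would put all vertices on one line. *)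
have tpm : tau wm < tau wp.
  rewrite lt_neqAle pmax ?mem_filter ?wmv// andbT; apply/eqP => E.
  apply: (not_flat vV a10) => w wV; have [->//|wv] := eqVneq w v.
  have wL : w \in L by rewrite mem_filter wv.
  have tw : tau w = tau wp by have := pmax w wL; have := mmax w wL; lra.
  by apply/eqP; rewrite -subr_eq0 e1// tw subrr mul0r.
have [r1 F1 [c1 c1p aE1]] : exists2 r, facet_normal v r & exists2 c,
  0 < c & a1 = scale_lattice_vec c r.
  apply: (@facet_normalP v wp) => //.
  by apply/eqP; rewrite -subr_eq0 e1// subrr mul0r.
have [r2 F2 [c2 c2p aE2]] : exists2 r, facet_normal v r & exists2 c,
  0 < c & a2 = scale_lattice_vec c r.
  apply: (@facet_normalP v wm) => //.
  by apply/eqP; rewrite -subr_eq0 e2// subrr mul0r.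
have tp : 0 < tau wp - tau wm by rewrite subr_gt0.
exists r1, r2, (c1 / (tau wp - tau wm)), (c2 / (tau wp - tau wm)); split=> //.
- by rewrite ltW// divr_gt0.
- by rewrite ltW// divr_gt0.
have [b1 b2] : c1 * r1.1%:~R = a1.1 /\ c1 * r1.2%:~R = a1.2 by rewrite aE1.
have [b3 b4] : c2 * r2.1%:~R = a2.1 /\ c2 * r2.2%:~R = a2.2 by rewrite aE2.
rewrite /scale_lattice_vec mulrAC b1 mulrAC b2 mulrAC b3 mulrAC b4.
rewrite (surjective_pairing u); congr pair; rewrite /a1 /a2 /=; field; exact: lt0r_neq0.
Qed.

End polygon.

Section polygon.
Context {R : realType}.
Variables (P : set (R * R)) (V : seq (int * int)) (H : int * int -> int).
Hypothesis Hmin : forall u : R * R,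
  exists2 v, v \in V & forall y, P y -> dot u (lattice_vec v) <= dot u y.
Hypothesis HvP : forall v, v \in V -> P (lattice_vec v).
Hypothesis HP : forall x : R * R,
  (forall u, exists2 v, v \in V & dot u (lattice_vec v) <= dot u x) -> P x.
Hypothesis Hex : forall u, exists2 v, v \in V & pairing u v = H u.
Hypothesis Hle : forall u v, v \in V -> H u <= pairing u v.
Hypothesis Pint : interior P !=set0.

Lemma lattice_vec_eq0 (u : int * int) : (lattice_vec u == 0 :> R * R) = (u == 0).
Proof. by rewrite -(inj_eq (@lattice_vec_inj R)). Qed.

Definition normal_bound : int := \sum_(r <- edge_normals V) (`|r.1| + `|r.2|).

Lemma normal_boundP r : r \in edge_normals V -> `|r.1| + `|r.2| <= normal_bound.
Proof.
move=> rV; rewrite /normal_bound (big_rem r)//= lerDl sumr_ge0// => s _.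
Qed.

(** Write [u = c1 r1 + c2 r2] with edge normals [r1, r2] of one vertex. If [c1 >= 1], then [u - r1]
    is still in the cone, so [u = r1]; likewise for [c2]. Otherwise both coefficients are below 1
    and the sizes of [r1] and [r2] bound [u]. *)
Lemma indec_bounded u : indecomposable H u -> `|u.1| <= 2 * normal_bound /\
  `|u.2| <= 2 * normal_bound.
Proof.
move=> Iu; have [u0 _] := Iu; have [v vV vE] := Hex u.
have Nu : rcone V v (lattice_vec u : R * R) by apply/rcone_lattice_vec => //;
  exact: (H_ncone Hle vE).
have u0' : lattice_vec u != 0 :> R * R by rewrite lattice_vec_eq0.
have [r1 [r2 [c1 [c2 [F1 F2 c10 c20 E]]]]] := normal_cone_decomp Hmin Pint vV u0' Nu.
have [r1R r10 N1 _] := F1; have [r2R r20 N2 _] := F2.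
have B1 := normal_boundP r1R; have B2 := normal_boundP r2R.
have [E1 E2] : u.1%:~R = c1 * r1.1%:~R + c2 * r2.1%:~R /\
  u.2%:~R = c1 * r1.2%:~R + c2 * r2.2%:~R :> R.
  by move: E; rewrite /lattice_vec /scale_lattice_vec => -[].
have half (x y B : int) : `|x| + `|y| <= B -> `|x| <= 2 * B /\ `|y| <= 2 * B.
  by clear; lia.
have big r c (r' : int * int) (c' : R) : r != 0 -> ncone V v r -> ncone V v r' ->
  1 <= c -> 0 <= c' ->
    u.1%:~R = c * r.1%:~R + c' * r'.1%:~R -> u.2%:~R = c * r.2%:~R + c' * r'.2%:~R ->
    u = r.
  move=> r0 Nr Nr' c1' c0' e1 e2; apply/eqP/contraT => ur.
  have ur0 : u - r != 0 by rewrite subr_eq0.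
  have [] := indec_ncone Hex Hle Iu vV r0 ur0 _ Nr; first by rewrite addrC subrK.
  apply/(@rcone_lattice_vec R) => w wV.
  have := proj2 (rcone_lattice_vec (R := R) V v r) Nr w wV;
    have := proj2 (rcone_lattice_vec (R := R) V v r') Nr' w wV.
  have D x : dot (lattice_vec (u - r)) x = (c - 1) * dot (lattice_vec r) x + c' * dot
    (lattice_vec r') x.
    by rewrite /dot /= !intrB e1 e2; ring.
  rewrite !D => h1 h2; apply: lerD; apply: ler_wpM2l => //.
  by rewrite subr_ge0.
have [c1b|c1b] := leP 1 c1.
  have := big _ _ _ _ r10 N1 N2 c1b c20 E1 E2 => ->.
  exact: half.
have [c2b|c2b] := leP 1 c2.
  rewrite [RHS]addrC in E1; rewrite [RHS]addrC in E2.
  have := big _ _ _ _ r20 N2 N1 c2b c10 E1 E2 => ->.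
  exact: half.
have bnd (x y z : int) : z%:~R = c1 * x%:~R + c2 * y%:~R :> R -> `|z| <= `|x| + `|y|.
  move=> e; rewrite -(ler_int R) intrD !intr_norm e; apply: le_trans (ler_normD _ _) _.
  rewrite !normrM (ger0_norm c10) (ger0_norm c20); apply: lerD; apply: ler_piMl => //;
    exact: ltW.
have h1 := bnd _ _ _ E1; have h2 := bnd _ _ _ E2.
move: B1 B2 h1 h2; move: normal_bound `|r1.1| `|r2.1| `|r1.2| `|r2.2|.
by clear; lia.
Qed.

(** At an interior lattice point the slack of an integer functional is a positive integer, hence at
    least 1. Conversely, slack 1 at the finitely many edge normals leaves room for a
    neighbourhood. *)
Lemma lattice_interior (x : int * int) :
  (forall u, u != 0 -> H u + 1 <= pairing u x) <-> interior P (lattice_vec x).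
Proof.
split=> [Hx|ix u u0].
  have B0 : 0 <= normal_bound by apply: sumr_ge0 => r _; rewrite addr_ge0.
  have B1 : 0 < 1 + normal_bound%:~R :> R by rewrite ltr_pwDl// ler0z.
  (* A displacement of this size changes the value of an edge normal by at most 1. *)
  apply: (@step_interior _ _ _ (1 + normal_bound%:~R)^-1); first by rewrite invr_gt0.
  move=> y H1 H2; apply: HP => u.
  have [v vV Nv] := rconeP Hmin HvP u; exists v => //.
  have [->|u0] := eqVneq u 0; first by rewrite /dot /= !mul0r.
  have [r1 [r2 [c1 [c2 [F1 F2 c10 c20 ->]]]]] := normal_cone_decomp Hmin Pint vV u0 Nv.
  have dD a b z : dot (a + b) z = dot a z + dot b z :> R by rewrite /dot /=; ring.
  have main r : facet_normal V v r -> dot (lattice_vec r) (lattice_vec v) <= dot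
    (lattice_vec r) y.
    move=> [rR r0 Nr _]; have := Hx r r0; rewrite -(ncone_H Hex Hle vV Nr).
    rewrite -!pairing_dot pairing_lattice_vec -(ler_int R) intrD => h.
    have -> : pairing r y = pairing r (lattice_vec x) + (r.1%:~R * (y.1 - x.1%:~R) +
      r.2%:~R * (y.2 - x.2%:~R)).
      by rewrite /pairing /=; ring.
    rewrite pairing_lattice_vec.
    have k1 : `|r.1%:~R * (y.1 - x.1%:~R)| <= `|r.1|%:~R * (1 + normal_bound%:~R)^-1.
      by rewrite normrM intr_norm ler_wpM2l// ltW.
    have k2 : `|r.2%:~R * (y.2 - x.2%:~R)| <= `|r.2|%:~R * (1 + normal_bound%:~R)^-1.
      by rewrite normrM intr_norm ler_wpM2l// ltW.
    have k3 : (`|r.1|%:~R + `|r.2|%:~R) * (1 + normal_bound%:~R)^-1 <= 1 :> R.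
      rewrite -intrD ler_pdivrMr// mul1r.
      by apply: (@le_trans _ _ (normal_bound%:~R));
        [rewrite ler_int normal_boundP|rewrite lerDr].
    have := ler_norm (- (r.1%:~R * (y.1 - x.1%:~R)));
      have := ler_norm (- (r.2%:~R * (y.2 - x.2%:~R))).
    rewrite !normrN; move: h k1 k2 k3; rewrite mulrDl; lra.
  by rewrite !dD !dot_scale_lattice_vec; apply: lerD; apply: ler_wpM2l => //; exact: main.
have u0' : lattice_vec u != 0 :> R * R by rewrite lattice_vec_eq0.
have [v vV] := interior_strict Hmin ix u0'.
rewrite -!pairing_dot !pairing_lattice_vec ltr_int => lt.
by rewrite lezD1; apply: le_lt_trans lt; exact: Hle.
Qed.

Variable c0 : int * int.
Hypothesis Hc0 : forall u, u != 0 -> H u + 1 <= pairing u c0.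
Variable U : seq (int * int).
Hypotheses (Uu : uniq U) (UE : forall u, u \in U <-> indecomposable H u).

Let fU : fan U := indec_fan Hex Hle Hc0 Uu UE.
Let U0 : U != [::] := indec_fan_neq0 Hc0 UE.

Lemma convex_P : @convex_set R (R * R)%type P.
Proof.
apply/convex_setP => x y t t0 t1 Px Py; apply: HP => u.
have [v vV vm] := Hmin u; exists v => //.
have /convex_setP := @convex_halfplane _ u (dot u (lattice_vec v)); apply => //=;
  exact: vm.
Qed.

Lemma polygonE : P = support_polygon U H.
Proof.
apply/seteqP; split=> [x Px u uU|].
  have [v vV vm] := Hmin (lattice_vec u); apply: le_trans (vm x Px).
  by rewrite -pairing_dot pairing_lattice_vec ler_int; exact: Hle.
apply: (support_polygon_sub fU U0 convex_P (s := V) HvP) => a b aU bU ab.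
have [v [vV Na Nb]] := indec_fan_cone Hex Hle Hc0 UE aU bU ab.
by exists v => //; split; exact: (ncone_H Hex Hle).
Qed.

Lemma support_ineqs_adjoint (x : int * int) : support_ineqs U (adjoint_support H) x ->
  forall u, u != 0 -> H u + 1 <= pairing u x.
Proof.
move=> Qx u u0.
have [a [b [al [be [aU bU ab [al0 be0 E]]]]]] := fan_cover fU U0 (lattice_vec u : R * R).
have D := adj_det ab.
(* Pairing with the rotated [q] is [det _ q], so evaluating [E] at the rotated [b] and [a] shows
   that the coordinates of [u] in the basis [a, b] are nonnegative. *)
have rdet (p q : int * int) : pairing p ((q.2)%:~R, - (q.1)%:~R) = (det p q)%:~R :> R.
  by rewrite /pairing /det /= intrB !intrM mulrN.
have i0 : 0 <= det u b.
  have := E ((b.2)%:~R, - (b.1)%:~R); rewrite -pairing_dot !rdet D detxx mulr1 mulr0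
    addr0.
  by rewrite -(ler0z R) => ->.
have j0 : 0 <= det a u.
  have := E ((a.2)%:~R, - (a.1)%:~R); rewrite -pairing_dot !rdet (detC a b) D detxx
    mulr0 add0r.
  by rewrite (detC a u) !intrN mulrN1 => /oppr_inj; rewrite -(ler0z R) => ->.
apply: le_trans (indec_nef Hex Hle Hc0 UE aU bU ab u0) _.
have := pairing_coord u x D; rewrite !intz => ->.
by apply: lerD; apply: ler_wpM2l => //; [have := Qx a aU|have := Qx b bU]; rewrite intz.
Qed.

(** For each cone [a, b] of the smooth fan, the point at which both inequalities of [h + 1] are
    tight is integral, and [indec_nef] makes it satisfy all the others. [support_polygon_sub] then
    bounds the polygon by the hull of its lattice points. *)
Lemma adjoint_polygonE (l : seq (int * int)) : (forall x, x \in l <->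
  support_ineqs U (adjoint_support H) x) ->
  interior_lattice_points P = [set lattice_vec x | x in [set` l]] /\
  convhull (interior_lattice_points P) = support_polygon U (adjoint_support H).
Proof.
move=> lP.
have YE : interior_lattice_points P = [set lattice_vec x | x in [set` l]].
  apply/seteqP; split=> [y [yi /lattice_floor yE]|_ [x xl <-]].
    exists (floor_vec y) => //; rewrite -yE in yi;
      have Hy := proj2 (lattice_interior _) yi.
    apply/lP => u uU; rewrite intz; apply: Hy.
    by have /UE[] := uU.
  split; last by split; rewrite intr_int.
  by apply/lattice_interior; apply: support_ineqs_adjoint; apply/lP.
split=> //; rewrite YE; apply/seteqP; split.
  apply: convhull_sub => [|_ [x /lP Qx <-] u uU].
    apply/convex_setP => x y t t0 t1 Qx Qy u uU.
    have /convex_setP := @convex_halfplane _ (lattice_vec u) ((adjoint_support H u)%:~R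
      : R); apply => //=.
      exact: Qx.
    exact: Qy.
  by rewrite pairing_lattice_vec ler_int; have := Qx u uU; rewrite intz.
apply: (support_polygon_sub fU U0 (@convex_convhull R _) (s := l)) => [v vl|a b aU bU ab].
  by apply: sub_convhull; exists v.
have D := adj_det ab; have [E1 E2] := lattice_col_pairing (adjoint_support H a)
  (adjoint_support H b) D.
eexists; last by split; [exact: E1|exact: E2].
apply/lP => w wU; rewrite intz (pairing_coord w _ D) E1 E2 !intz.
by apply: (indec_nef Hex Hle Hc0 UE aU bU ab); have /UE[] := wU.
Qed.

End polygon.

(** * Rays of the smooth refinement *)

Lemma card_set_image (T : eqType) (T' : choiceType) (f : T -> T') (s : seq T) :
  uniq s -> {in s &, injective f} -> card_set [set f x | x in [set` s]] = size s.
Proof.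
move=> us finj; rewrite -(size_map f) /card_set.
have -> : [set f x | x in [set` s]] = [set` [fset y in map f s]%fset].
  apply/seteqP; split=> y /=; rewrite in_fset /=.
    by case=> x xs <-; exact: map_f.
  by move=> /mapP[x xs ->]; exists x.
by rewrite set_fsetK card_fseq undup_id// map_inj_in_uniq.
Qed.

Section bounded.
Context {R : realType}.

Lemma bounded_setP (E : set (R * R)) : bounded_set E <->
  exists M : R, forall x, E x -> `|x.1| <= M /\ `|x.2| <= M.
Proof.
split=> [/pinfty_ex_gt0[M M0 H]|[M H]].
  by exists M => x Ex; have := H x Ex; rewrite /= prod_normE ge_max => /andP[].
exists M; split; first exact: num_real.
move=> M' MM' x Ex; have [H1 H2] := H x Ex.
by rewrite /= prod_normE ge_max !(le_trans _ (ltW MM')).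
Qed.

End bounded.

Section rays.
Context {R : realType}.
Variables (P : set (R * R)) (V : seq (int * int)) (H : int * int -> int).
Hypothesis Hmin : forall u : R * R,
  exists2 v, v \in V & forall y, P y -> dot u (lattice_vec v) <= dot u y.
Hypothesis HvP : forall v, v \in V -> P (lattice_vec v).
Hypothesis HP : forall x : R * R,
  (forall u, exists2 v, v \in V & dot u (lattice_vec v) <= dot u x) -> P x.
Hypothesis Hex : forall u, exists2 v, v \in V & pairing u v = H u.
Hypothesis Hle : forall u v, v \in V -> H u <= pairing u v.
Hypothesis Pint : interior P !=set0.

Lemma dotC (a b : R * R) : dot a b = dot b a.
Proof. rewrite /dot; ring. Qed.

Lemma dotDl (a b x : R * R) : dot (a + b) x = dot a x + dot b x.
Proof. rewrite /dot /=; ring. Qed.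

Lemma dotZl (c : R) (a x : R * R) : dot (c *: a) x = c * dot a x.
Proof. by rewrite /dot mulrDr !mulrA. Qed.

Lemma rcone_face v (u : R * R) : v \in V -> rcone V v u <-> face P u (lattice_vec v).
Proof.
move=> vV; split=> [N|[_ m] w wV]; last exact/m/HvP.
split; first exact: HvP.
move=> y Py; have [w wV wm] := Hmin u; apply: le_trans (wm y Py).
exact: N.
Qed.

(** The generators are minimal at [v] because their edges contain [v]; conversely,
    [normal_cone_decomp] expresses [u] by two edge normals at [v]. *)
Lemma normal_coneE v (u : R * R) : v \in V ->
  normal_cone P (lattice_vec v) u <-> rcone V v u.
Proof.
move=> vV; split=> [[m [c [a [ca ->]]]] w wV|N].
  have dsum x : dot (\sum_(i < m) c i *: a i) x = \sum_(i < m) c i * dot (a i) x.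
    elim/big_rec2: _ => [|i y1 y2 _ <-]; first by rewrite /dot /= !mul0r addr0.
    by rewrite dotDl dotZl.
  rewrite !dsum; apply: ler_sum => i _; have [c0 [E [_ Ev [_ Ef]]]] := ca i.
  apply: ler_wpM2l => //; have := Ef _ Ev; move/(rcone_face (a i) vV); exact.
have [->|u0] := eqVneq u 0.
  exists 0, (fun _ => 0), (fun _ => 0); split; first by case.
  by rewrite big_ord0.
have [r1 [r2 [c1 [c2 [F1 F2 c10 c20 ->]]]]] := normal_cone_decomp Hmin Pint vV u0 N.
have main r : facet_normal V v r ->
    exists E, [/\ edge P E, E (lattice_vec v) & inner_normal P E (lattice_vec r)].
  move=> [_ r0 Nr [w [wV wv E]]].
  have fv : face P (lattice_vec r) (lattice_vec v) by apply/rcone_face => //;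
    exact/rcone_lattice_vec.
  have r0' : lattice_vec r != 0 :> R * R by rewrite lattice_vec_eq0.
  exists (face P (lattice_vec r)); split=> //; split=> //;
    first by exists (lattice_vec r).
  exists (lattice_vec v), (lattice_vec w); split=> //;
    last by rewrite (inj_eq (@lattice_vec_inj R)) eq_sym.
  split; first exact: HvP.
  by move=> y Py; have [_ /(_ y Py)] := fv; rewrite -!pairing_dot !pairing_lattice_vec E.
exists 2%N, (fun i : 'I_2 => if i == ord0 then c1 else c2),
  (fun i : 'I_2 => if i == ord0 then lattice_vec r1 else lattice_vec r2).
split.
  by move=> i; case: ifP => _; split=> //=; exact: main.
rewrite !big_ord_recl big_ord0 /= addr0; congr (_ + _).
Qed.

Variable c0 : int * int.
Hypothesis Hc0 : forall u, u != 0 -> H u + 1 <= pairing u c0.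
Variable U : seq (int * int).
Hypotheses (Uu : uniq U) (UE : forall u, u \in U <-> indecomposable H u).

Lemma convex_rcone v : @convex_set R (R * R)%type (rcone V v).
Proof.
apply/convex_setP => x y t t0 t1 Nx Ny w wV.
have D z : dot (t * x.1 + (1 - t) * y.1, t * x.2 + (1 - t) * y.2) z =
  t * dot x z + (1 - t) * dot y z by rewrite /dot /=; ring.
by rewrite !D; apply: lerD; apply: ler_wpM2l; rewrite ?subr_ge0 ?Nx ?Ny.
Qed.

Section cone.
Variable v : int * int.
Hypothesis vV : v \in V.

Let S := normal_cone P (lattice_vec v) `&` (lattice `\ 0).
Let K := convhull S.

Lemma cone_latticeP (p : R * R) : S p <-> exists q, [/\ p = lattice_vec q,
  q != 0 & ncone V v q].
Proof.
split=> [[/(normal_coneE p vV) N [/lattice_floor pE p0]]|[q [-> q0 Nq]]].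
  exists (floor_vec p); split=> //.
    by apply/eqP => q0; apply: p0; rewrite -pE q0 /=.
  by apply/(@rcone_lattice_vec R); rewrite pE.
split; first by apply/normal_coneE => //; apply/rcone_lattice_vec.
split; first by split; rewrite /= intr_int.
by move=> /eqP; rewrite lattice_vec_eq0; apply/negP.
Qed.

Lemma K_rcone : K `<=` rcone V v.
Proof.
apply: convhull_sub => [|p [/normal_coneE]]; first exact: convex_rcone.
by move/(_ vV).
Qed.

Lemma K_halfplane (e : R * R) (c : R) :
  (forall q, q != 0 -> ncone V v q -> c <= dot e (lattice_vec q)) -> forall x, K x ->
    c <= dot e x.
Proof.
move=> h; suff : K `<=` [set x | c <= dot e x] by [].
apply: convhull_sub => [|p /cone_latticeP[q [-> q0 Nq]]]; first exact: convex_halfplane.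
exact: h.
Qed.

(** The functional [g] that cuts out the edge is nonnegative on the cone, as [p + a] stays in [K].
    If [p = a + b] in the cone, minimality at [p] against [a] and [b] forces [g] to vanish at [p],
    and then the edge contains all positive multiples of [p]. *)
Lemma bounded_edge_indec E p : edge K E -> bounded_set E -> (E `&` lattice) p ->
  exists2 q, p = lattice_vec q & indecomposable H q.
Proof.
move=> [[g [g0 EE]] _] /bounded_setP[M HM] [Ep /lattice_floor/esym pE].
have [Kp gm] : face K g p by rewrite -EE.
move: (floor_vec p) pE => q pE.
exists q => //; have Nq : ncone V v q.
  by apply/(@rcone_lattice_vec R); rewrite -pE; exact: K_rcone.
have kpos q' : q' != 0 -> ncone V v q' -> 1 <= pairing q' c0 - pairing q' v.
  by move=> q0 N; rewrite lerBrDr addrC lezD1; exact: (ncone_c0 Hex Hle Hc0).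
(* This functional is at least 1 on [K], which keeps [0] out of [K]. *)
pose e : R * R := ((c0.1 - v.1)%:~R, (c0.2 - v.2)%:~R).
have dote q' : dot e (lattice_vec q') = (pairing q' c0 - pairing q' v)%:~R.
  by rewrite !pairing_int /dot /e /= !(intrD, intrB, intrM, intrN) ; ring.
have q0 : q != 0.
  apply/eqP => q0; have : (1 : R) <= dot e p.
    by apply: K_halfplane => // q' q'0 N'; rewrite dote -[1]/(1%:~R) ler_int kpos.
  by rewrite pE q0 /dot /= !mulr0 addr0 ler10.
have KS q' : q' != 0 -> ncone V v q' -> K (lattice_vec q').
  by move=> q'0 N'; apply: sub_convhull; apply/cone_latticeP; exists q'.
have nz a b : a != 0 -> ncone V v a -> ncone V v b -> a + b != 0.
  move=> a0 Na Nb; apply/eqP => ab; have := kpos a a0 Na.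
  have [b0|b0] := eqVneq b 0; first by move: ab a0; rewrite b0 addr0 => ->; rewrite eqxx.
  have := kpos b b0 Nb; have := pairingD a b c0; have := pairingD a b v.
  by rewrite ab !pairing0; lia.
have gge a : a != 0 -> ncone V v a -> 0 <= dot g (lattice_vec a).
  move=> a0 Na; have /gm : K (lattice_vec (q + a)) by apply: KS;
    [exact: nz|exact: nconeD].
  have -> : lattice_vec (q + a) = lattice_vec q + lattice_vec a :> R * R by rewrite
    /lattice_vec /= !intrD.
  by rewrite pE [X in _ <= X]dotC dotDl -!(dotC g) lerDl.
split=> // a b a0 b0 qE; rewrite ltNge; apply/negP => le.
have [Na Nb] := ncone_split Hex Hle vV Nq qE le.
have ga := gge a a0 Na; have gb := gge b b0 Nb.
have := gm _ (KS a a0 Na); have := gm _ (KS b b0 Nb).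
have -> : dot g p = dot g (lattice_vec a) + dot g (lattice_vec b).
  have -> : p = lattice_vec a + lattice_vec b by rewrite pE qE /lattice_vec /= !intrD.
  by rewrite dotC dotDl -!(dotC g).
move=> hb ha; have gp0 : dot g p = 0.
  have -> : p = lattice_vec a + lattice_vec b by rewrite pE qE /lattice_vec /= !intrD.
  by rewrite dotC dotDl -!(dotC g); lra.
have mult (m : nat) : E (m.+1%:R *: p).
  rewrite EE; split.
    have -> : m.+1%:R *: p = lattice_vec (comb m.+1%:Z 0 q q).
      by rewrite pE /lattice_vec /comb /= !mul0r !addr0 !intrM.
    apply: KS; last exact: ncone_comb.
    by apply: contraNneq q0 => -[/eqP + /eqP];
      rewrite !mul0r !addr0 !mulf_eq0 /= => /eqP q1 /eqP q2;
        rewrite (surjective_pairing q) q1 q2.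
  by move=> y Ky; rewrite dotC dotZl -dotC gp0 mulr0 -gp0; exact: gm.
pose m := (Num.truncn M).+1.
have Mm : M < m.+1%:R by apply: lt_le_trans (truncnS_gt M) _; rewrite ler_nat.
have [h1 h2] := HM _ (mult m).
have big (z : int) : z != 0 -> M < `|m.+1%:R * z%:~R|.
  move=> z0; apply: lt_le_trans Mm _; rewrite normrM normr_nat ler_peMr//.
  by rewrite -intr_norm -[1]/(1%:~R) ler_int -gtz0_ge1 normr_gt0.
have [z|z] := pair_neq0 q0.
  by have := big _ z; rewrite ltNge; move: h1; rewrite pE /= => ->.
by have := big _ z; rewrite ltNge; move: h2; rewrite pE /= => ->.
Qed.

(** The lattice point [x] of [h + 1] on the cone [u, b] is interior to [P], so [e = x - v] is at
    least 1 on [K], with equality at [u] and [b]; it cuts out the edge through both. *)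
Lemma indec_bounded_edge u b : indecomposable H u -> indecomposable H b -> adj U u b ->
  ncone V v u -> ncone V v b ->
  exists E, [/\ edge K E, bounded_set E & (E `&` lattice) (lattice_vec u)].
Proof.
move=> Iu Ib ub Nu Nb; have D := adj_det ub.
have [u0 _] := Iu; have [b0 _] := Ib.
have uU : u \in U by apply/UE.
have bU : b \in U by apply/UE.
have [x [xu xb]] : exists x, pairing u x = H u + 1 /\ pairing b x = H b + 1.
  by eexists; exact: lattice_col_pairing.
have Hx w : w != 0 -> H w + 1 <= pairing w x.
  move=> w0; apply: le_trans (indec_nef Hex Hle Hc0 UE uU bU ub w0) _.
  by have := pairing_coord w x D; rewrite !intz => ->; rewrite xu xb.
pose e : R * R := ((x.1 - v.1)%:~R, (x.2 - v.2)%:~R).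
have doteE y : dot e y = dot y (lattice_vec x) - dot y (lattice_vec v).
  by rewrite /dot /e /= !intrB; ring.
have dote q : dot e (lattice_vec q) = (pairing q x - pairing q v)%:~R.
  by rewrite doteE -!pairing_dot !pairing_lattice_vec intrB.
have e1 y : K y -> 1 <= dot e y.
  apply: K_halfplane => q q0 Nq; rewrite dote -[1]/(1%:~R) ler_int.
  by rewrite (ncone_H Hex Hle vV Nq) lerBrDr addrC; exact: Hx.
have KS q' : q' != 0 -> ncone V v q' -> K (lattice_vec q').
  by move=> q'0 N'; apply: sub_convhull; apply/cone_latticeP; exists q'.
have eu : dot e (lattice_vec u) = 1 by rewrite dote xu (ncone_H Hex Hle vV Nu) addrAC
  subrr add0r.
have eb : dot e (lattice_vec b) = 1 by rewrite dote xb (ncone_H Hex Hle vV Nb) addrAC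
  subrr add0r.
have fu : face K e (lattice_vec u) by split; [exact: KS|move=> y /e1; rewrite eu].
have fb : face K e (lattice_vec b) by split; [exact: KS|move=> y /e1; rewrite eb].
exists (face K e); split.
- split.
    exists e; split=> //; apply/eqP => e0; move: eu; rewrite e0 /dot /= !mul0r addr0.
    by move/esym/eqP; rewrite oner_eq0.
  exists (lattice_vec u), (lattice_vec b); split=> //;
    rewrite (inj_eq (@lattice_vec_inj R)).
  by apply/eqP => E; move: D; rewrite E detxx.
- apply/bounded_setP.
  have ix : interior P (lattice_vec x) by apply: (proj1 (lattice_interior Hmin HvP HP
    Hex Hle Pint x) Hx).
  have [rho r0 Hr] := interior_step ix.
  (* [y] is minimal at [v] over [P] and exceeds that minimum by 1 at [x]. Moving [x] by [rho / 2]
     along either axis stays in [P], so each coordinate of [y] is at most [2 / rho] in absolute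
     value. *)
  exists (2 / rho) => y [Ky ym].
  have Ny : forall z, P z -> dot y (lattice_vec v) <= dot y z.
    by have /(rcone_face y vV)[] := K_rcone Ky.
  have ey : dot y (lattice_vec x) - dot y (lattice_vec v) = 1.
    by rewrite -doteE; apply/eqP; rewrite eq_le (e1 _ Ky) andbT -eu; apply: ym; case: fu.
  have h0 : `|rho / 2| < rho by rewrite gtr0_norm ?divr_gt0//; lra.
  have z0 : `|0 : R| < rho by rewrite normr0.
  have hN : `|- (rho / 2)| < rho by rewrite normrN.
  have Px (s t : R) : `|s| < rho -> `|t| < rho -> P (x.1%:~R + s, x.2%:~R + t).
    by move=> hs ht; apply: Hr; rewrite /= addrAC subrr add0r.
  have N1 := Ny _ (Px _ _ h0 z0); have N2 := Ny _ (Px _ _ hN z0).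
  have N3 := Ny _ (Px _ _ z0 h0); have N4 := Ny _ (Px _ _ z0 hN).
  move: N1 N2 N3 N4 ey; rewrite /dot /= => N1 N2 N3 N4 ey.
  by split; rewrite ler_pdivlMr// -(gtr0_norm r0) -normrM ler_norml; apply/andP; split;
    lra.
- split=> //; split; rewrite /= intr_int; by [].
Qed.

End cone.

Hypothesis Hv : forall v, v \in V -> vertex P (lattice_vec v).
Hypothesis Hvertex : forall w, vertex P w -> exists2 v, v \in V & w = lattice_vec v.

Lemma smooth_rays_indec :
  smooth_refinement_rays P = [set ray (lattice_vec u) | u in [set` U]].
Proof.
apply/seteqP; split=> [r [w /Hvertex[v vV ->]] [E [p [KE bE Ep ->]]]|_ [u uU <-]].
  have [q -> Iq] := bounded_edge_indec vV KE bE Ep.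
  by exists q => //; apply/UE.
have [b [v [bU ub vV Nu Nb]]] := indec_fan_succ Hex Hle Hc0 UE uU.
have Iu := proj1 (UE u) uU; have Ib := proj1 (UE b) bU.
have [E [KE bE Ep]] := indec_bounded_edge vV Iu Ib ub Nu Nb.
by exists (lattice_vec v); [exact: Hv|exists E, (lattice_vec u)].
Qed.

(** If [u = t w] and [x] follows [w], then [t = det u x] is an integer, so [fan_primitive]
    applies. *)
Lemma ray_inj : {in U &, injective (fun u => ray (lattice_vec u : R * R))}.
Proof.
move=> u w uU wU /= E.
have fU : fan U := indec_fan Hex Hle Hc0 Uu UE.
have [_ Us] := fU; have [x xU wx] := Us w wU.
have [t t0 /= tE] : ray (lattice_vec w : R * R) (lattice_vec u).
  by rewrite -E; exists 1 => //=; rewrite scale1r.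
have [e1 e2] : t * w.1%:~R = u.1%:~R /\ t * w.2%:~R = u.2%:~R by move: tE;
  rewrite /lattice_vec => -[].
have tD : t = (det u x)%:~R.
  rewrite /det intrB !intrM -e1 -e2 -!mulrA -mulrBr -!intrM -intrB.
  by rewrite -[_ - _]/(det w x) (adj_det wx) mulr1.
apply: (fan_primitive (m := det u x) fU uU).
  rewrite -(ltr0z R) -tD lt_neqAle t0 andbT eq_sym; apply/eqP => tz.
  have [u0 _] := proj1 (UE u) uU; move: u0; apply/negP;
    rewrite negbK -(lattice_vec_eq0 (R := R)).
  by rewrite /lattice_vec -e1 -e2 tz !mul0r.
rewrite (surjective_pairing u); congr pair; apply/eqP; rewrite -(eqr_int R) intrM -tD.
  by rewrite e1.
by rewrite e2.
Qed.

End rays.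

Unset Implicit Arguments.

Theorem theorem1p3 (R : realType) (P : set (R * R)) (k : nat) :
  lattice_polygon P ->
  k = card_set (interior_lattice_points P) ->
  (1 <= k)%N ->
  area P =
    ((2 * (k%:R + 1) + 2 - (card_set (smooth_refinement_rays P))%:R / 2 : R)%:E
     - area (convhull (interior_lattice_points P)))%E.
Proof.
move=> latP kE k1; have [[_ Pint] _] := latP.
have [V [Hv Hvertex Hmin HP]] := polygon_vertices latP.
have HvP v : v \in V -> P (lattice_vec v).
  by move=> /Hv[u fu]; have [] : face P u (lattice_vec v) by rewrite fu.
have V0 : V != [::] by have [v vV _] := Hmin 0; apply/eqP => E; rewrite E in vV.
have /choice[H HH] : forall u : int * int, exists z : int,
    (exists2 v, v \in V & pairing u v = z) /\ forall v, v \in V -> z <= pairing u v.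
  move=> u; have [v vV vmax] := seq_argmax (fun v : int * int => - pairing u v) V0.
  by exists (pairing u v); split=> [|w /vmax]; [exists v|rewrite lerN2].
have Hex u := proj1 (HH u).
have Hle u v : v \in V -> H u <= pairing u v := proj2 (HH u) v.
(* [card_set] of the empty set is 0, so [1 <= k] provides an interior lattice point. *)
have [c0 ic0] : exists c0 : int * int, interior P (lattice_vec c0).
  have : interior_lattice_points P !=set0.
    by apply/set0P/eqP => Y0; move: k1; rewrite kE Y0 /card_set fset_set0.
  by move=> [y [iy /lattice_floor yE]]; exists (floor_vec y); rewrite yE.
have Hc0 := proj2 (lattice_interior Hmin HvP HP Hex Hle Pint c0) ic0.
have [U [Uu UE]] := bounded_list (indec_bounded Hmin Hex Hle Pint).
have fU := indec_fan Hex Hle Hc0 Uu UE; have U0 := indec_fan_neq0 Hc0 UE.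
have nef := indec_globally_nef Hex Hle Hc0 UE;
  have nef1 := indec_adjoint_globally_nef Hex Hle Hc0 UE.
have [A [A' [l [aA aA' ul lP F]]]] := @fan_adjoint_formula R U H fU U0 nef nef1.
have PQ := polygonE Hmin HvP HP Hex Hle Hc0 Uu UE.
have [YE hY] := adjoint_polygonE Hmin HvP HP Hex Hle Pint Hc0 Uu UE lP.
have kl : k = size l.
  by rewrite kE YE; apply: card_set_image => // x y _ _; exact: lattice_vec_inj.
have nU : card_set (smooth_refinement_rays P) = size U.
  rewrite (smooth_rays_indec Hmin HvP HP Hex Hle Pint Hc0 Uu UE Hv Hvertex).
  by apply: card_set_image => //; exact: (ray_inj Hex Hle Hc0 Uu UE).
rewrite hY [in LHS]PQ nU aA aA' -EFinB kl; congr EFin; lra.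
Qed.
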